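(* For every rational number $\alpha\in(0,1)$, the following optimization problem is NP-hard: given positive integers $n,m$, a symmetric matrix $\mathbf{S}\in\mathbb{Q}^{n\times n}$ with $S_{ii}=0$ for all $i$ and $S_{ij}\ge 0$ for all $i\neq j$, and a matrix $\mathbf{A}\in\mathbb{Q}^{n\times m}$ with nonnegative entries, solve $$ \begin{array}{lll} \min\limits_{\mathbf{x}\in\mathbb{R}^n,\ v\in\mathbb{R}} & (1-\alpha)\,\mathbf{x}^T\mathbf{S}\mathbf{x}+\alpha v & \\ \text{s.t.} & v\ \geq\ \mathbf{x}^T\mathbf{A}\mathbf{e}_i & i=1,\ldots,m,\\ & \sum_{j=1}^n x_j = 1, & \\ & x_j\geq 0 & j=1,\ldots,n, \end{array} $$ where $\mathbf{e}_i\in\mathbb{R}^m$ denotes the $i$-th unit vector.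
   Context: The problem arises from a matrix game with payoff matrix $\mathbf{A}$ (player 1 has $n$ strategies, player 2 has $m$ strategies) and switching cost matrix $\mathbf{S}$, scalarized with weight $\alpha$. NP-hardness of the optimization problem is understood via its associated decision problem, under polynomial-time many-one reductions: given the data $(n,m,\mathbf{S},\mathbf{A})$ as in the claim and a rational constant $\xi\geq 0$, does there exist a feasible $(\mathbf{x},v)$ with $(1-\alpha)\,\mathbf{x}^T\mathbf{S}\mathbf{x}+\alpha v\leq \xi$? Equivalently: does there exist $\mathbf{x}$ in the unit simplex $\Delta_n=\{\mathbf{x}\in\mathbb{R}^n_{+} : \sum_{j=1}^n x_j=1\}$ with $(1-\alpha)\,\mathbf{x}^T\mathbf{S}\mathbf{x}+\alpha\max_{i=1,\ldots,m}\mathbf{x}^T\mathbf{A}\mathbf{e}_i\leq \xi$? The input is encoded in binary in the usual way. *)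

(* Defs.v *)
From HB Require Import structures.
From mathcomp Require Import all_boot all_order all_algebra.
From mathcomp Require Import reals.

Set Implicit Arguments.
Unset Strict Implicit.
Unset Printing Implicit Defensive.

Import Order.TTheory GRing.Theory Num.Theory.

Notation bits := (seq bool).

(** * Deterministic multi-tape Turing machines *)

(* [None] is the blank, [Some (inl b)] a bit, [Some (inr a)] a work symbol. *)
Definition symbol (A : finType) : finType := option (bool + A).

Inductive direction := Left | Stay | Right.

(* [step q s = None] means that the machine halts in state [q] when its heads
   read the symbols [s]. *)
Record machine := Machine {
  state : finType;
  work_symbol : finType;
  ntapes : nat;
  start : state;
  step : state -> {ffun 'I_ntapes.+1 -> symbol work_symbol} ->
    option (state * ('I_ntapes.+1 -> symbol work_symbol * direction))
}.

(* The tape [(l, r)] is two-way infinite: [l] lists the cells strictly to the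
   left of the head, nearest first, [r] those from the head on to the right;
   all other cells are blank. *)
Definition tape (A : finType) : Type := seq (symbol A) * seq (symbol A).

Definition read (A : finType) (t : tape A) : symbol A := head None t.2.

Definition write (A : finType) (a : symbol A) (t : tape A) : tape A :=
  (t.1, a :: behead t.2).

Definition move (A : finType) (d : direction) (t : tape A) : tape A :=
  match d with
  | Left => (behead t.1, head None t.1 :: t.2)
  | Stay => t
  | Right => (read t :: t.1, behead t.2)
  end.

Section Run.
Variable M : machine.

Let tapeM := tape (work_symbol M).

Definition config : Type := state M * {ffun 'I_(ntapes M).+1 -> tapeM}.

Definition next (c : config) : option config :=
  if step c.1 [ffun i => read (c.2 i)] is Some (q, act) then
    Some (q, [ffun i => move (act i).2 (write (act i).1 (c.2 i))])
  else None.

(* The [i]-th word of [ws] is on tape [i], with the head on its first letter;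
   the remaining tapes are blank. *)
Definition init (ws : seq bits) : config :=
  (start M,
   [ffun i : 'I_(ntapes M).+1 =>
      ([::], [seq Some (inl b) | b <- nth [::] ws i]) : tapeM]).

(* A halted configuration is left unchanged. *)
Definition run (t : nat) (c : config) : config :=
  iter t (fun c' => odflt c' (next c')) c.

Fixpoint leading_bits (s : seq (symbol (work_symbol M))) : bits :=
  if s is Some (inl b) :: s' then b :: leading_bits s' else [::].

(* The output is on tape [0], from the head up to the first non-bit. *)
Definition output (c : config) : bits := leading_bits (c.2 ord0).2.

Definition computes_within (ws : seq bits) (w : bits) (t : nat) : Prop :=
  let c := run t (init ws) in next c = None /\ output c = w.

End Run.

(** * Polynomial time, NP, many-one hardness *)

(* One machine computes [f d] from the words [inp d], for all [d], in time
   polynomial in the total length of these words. *)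
Definition poly_time (D : Type) (inp : D -> seq bits) (f : D -> bits) : Prop :=
  exists (M : machine) (p : {poly nat}), forall d : D,
    (size (inp d) <= (ntapes M).+1)%N /\
    computes_within M (inp d) (f d) (p.[sumn (map size (inp d))])%R.

Definition in_NP (L : bits -> Prop) : Prop :=
  exists (V : bits -> bits -> bool) (q : {poly nat}),
    poly_time (fun xy : bits * bits => [:: xy.1; xy.2])
              (fun xy => [:: V xy.1 xy.2]) /\
    forall x, L x <-> exists2 y : bits, (size y <= q.[size x]%R)%N & V x y.

Record decision_problem := DecisionProblem {
  dinst : Type;
  dencode : dinst -> bits;
  yes : dinst -> Prop
}.

Definition NP_hard (Q : decision_problem) : Prop :=
  forall L : bits -> Prop, in_NP L ->
    exists f : bits -> dinst Q,
      poly_time (fun w : bits => [:: w]) (fun w => dencode (f w)) /\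
      forall w, L w <-> yes (f w).

(** * Binary encodings *)

(* Binary digits, least significant first; [0] has no digits. *)
Definition digits (n : nat) : bits :=
  mkseq (fun i => odd (n %/ 2 ^ i)) (up_log 2 n.+1).

(* Each digit is preceded by [true] and the number is closed by [false], so
   that concatenated codes can be parsed. *)
Definition encode_nat (n : nat) : bits :=
  flatten [seq [:: true; b] | b <- digits n] ++ [:: false].

Definition encode_int (z : int) : bits := (z < 0)%R :: encode_nat `|z|%N.

Definition encode_rat (r : rat) : bits :=
  encode_int (numq r) ++ encode_int (denq r).

(* Entries are listed row by row. *)
Definition encode_mx (n m : nat) (B : 'M[rat]_(n, m)) : bits :=
  flatten [seq encode_rat (B i j) | i <- enum 'I_n, j <- enum 'I_m].

(** * Minimization problems *)

Local Open Scope ring_scope.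

Record min_problem (R : realType) := MinProblem {
  inst : Type;
  encode : inst -> bits;
  solution : inst -> Type;
  feasible : forall I : inst, solution I -> Prop;
  objective : forall I : inst, solution I -> R
}.

Definition decision_version (R : realType) (Q : min_problem R) :
    decision_problem :=
  {| dinst := inst Q * {xi : rat | 0 <= xi};
     dencode := fun J => encode J.1 ++ encode_rat (val J.2);
     yes := fun J => exists2 s : solution J.1,
       feasible s & objective s <= ratr (val J.2) |}.

Definition NP_hard_min (R : realType) (Q : min_problem R) : Prop :=
  NP_hard (decision_version Q).

(** * Matrix games with switching costs *)

Record game := Game {
  rows : nat;
  cols : nat;
  switching : 'M[rat]_rows;
  payoff : 'M[rat]_(rows, cols);
  rows_gt0 : (0 < rows)%N;
  cols_gt0 : (0 < cols)%N;
  switching_sym : switching^T = switching;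
  switching_diag : forall i, switching i i = 0;
  switching_ge0 : forall i j, i != j -> 0 <= switching i j;
  payoff_ge0 : forall i j, 0 <= payoff i j
}.

Definition encode_game (G : game) : bits :=
  encode_nat (rows G) ++ encode_nat (cols G) ++
  encode_mx (switching G) ++ encode_mx (payoff G).

Section SwitchingGame.
Variables (R : realType) (alpha : rat).

Definition game_solution (G : game) : Type := 'cV[R]_(rows G) * R.

Definition game_feasible (G : game) (s : game_solution G) : Prop :=
  let: (x, v) := s in
  [/\ forall i : 'I_(cols G),
        (x^T *m map_mx ratr (payoff G) *m (delta_mx i 0 : 'cV[R]_(cols G))) 0 0
          <= v,
      \sum_(j < rows G) x j 0 = 1 &
      forall j : 'I_(rows G), 0 <= x j 0].

Definition game_objective (G : game) (s : game_solution G) : R :=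
  let: (x, v) := s in
  (1 - ratr alpha) * (x^T *m map_mx ratr (switching G) *m x) 0 0
    + ratr alpha * v.

Definition switching_game_problem : min_problem R :=
  {| encode := encode_game;
     feasible := game_feasible;
     objective := game_objective |}.

End SwitchingGame.

(* Main.v *)
Require Import Defs.
From mathcomp Require Import all_boot all_order all_algebra.
From mathcomp Require Import boolp reals.
From mathcomp Require Import zify ring.

(** The proof reduces an arbitrary language in NP, given by a verifier machine,
    directly to the game problem.

    Satisfying a system of binary constraints, that is, choosing one vertex in
    each of [K] groups of [h] vertices so that no two chosen vertices conflict,
    is a special case of the game problem ([conflict_gameP]). Take for [S] the
    0/1 matrix of conflicts between vertices of different groups, and for [A]
    the matrix whose column [j] measures the weight that [x] gives to the group
    of [j]. The weights of the groups sum to one, so the payoff term is least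
    exactly when all groups have the same weight; a value equal to this least
    payoff leaves nothing for [x^T S x], hence the support of [x] meets every
    group and is free of conflicts. Conversely, the uniform distribution on a
    choice without conflicts attains that value. The constants are chosen so
    that the decision bound is [1 / (K * h)].

    A run of the verifier is such a choice ([tableauP]). There is one group for
    each time [t] and each distance [p] to the heads; a vertex of the group
    is a cell of constant size, which records the state, the symbols read, and
    what every tape holds at that distance on either side of its head.
    Because positions are relative to the heads, a step of the machine relates
    the cell [(t, p)] only to the cells [(t.+1, p)], [(t.+1, p.+1)] and
    [(t.+1, p.-1)], even if the heads of the tapes are far apart. The
    witness is what the second tape holds at time 0. A constraint on
    a single cell becomes a conflict with the vertices of all other groups.

    It remains to print the instance in polynomial time. Tapes are used as
    stacks, and programs are composed by [bind] and [loop] with a specification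
    [runs] that bounds the number of steps. Numbers are
    manipulated in unary, as lengths of registers. The time bound [T] and the bound on
    the length of the witness are computed by Horner's rule
    ([computes_eval_poly]); the two matrices are printed by four nested loops
    over [0, ..., T.-1] ([prints_pair_loop]), the finitely many cells
    being unrolled in the program; and the number of vertices, which is the
    only number with an unbounded binary code, is converted by repeated
    halving ([computes_to_binary]). As a program cannot use more space than
    time ([runs_size]), polynomial time bounds compose ([computes_seq]). *)

Set Implicit Arguments.
Unset Strict Implicit.
Unset Printing Implicit Defensive.

Import Order.TTheory GRing.Theory Num.Theory.

(** * Polynomial bounds *)

Definition poly_bounded (c : nat -> nat) :=
  exists P : {poly nat}, forall b, c b <= P.[b]%R.

Lemma horner_nat_mono (P : {poly nat}) a b : a <= b -> P.[a]%R <= P.[b]%R.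
Proof.
rewrite /horner => le; elim: (polyseq P) => //= c s IH.
by rewrite leq_add2r leq_mul.
Qed.

Lemma poly_bounded_le c d :
  (forall b, c b <= d b) -> poly_bounded d -> poly_bounded c.
Proof. by move=> le [P H]; exists P => b; apply: leq_trans (H b). Qed.

Lemma poly_bounded_const a : poly_bounded (fun=> a).
Proof. by exists (a%:P)%R => b; rewrite hornerC. Qed.

Lemma poly_bounded_id : poly_bounded id.
Proof. by exists 'X%R => b; rewrite hornerX. Qed.

Lemma poly_boundedD c d :
  poly_bounded c -> poly_bounded d -> poly_bounded (fun b => c b + d b).
Proof. by move=> [P H] [Q K]; exists (P + Q)%R => b; rewrite hornerD leq_add. Qed.

Lemma poly_boundedM c d :
  poly_bounded c -> poly_bounded d -> poly_bounded (fun b => c b * d b).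
Proof. by move=> [P H] [Q K]; exists (P * Q)%R => b; rewrite hornerM leq_mul. Qed.

Lemma poly_boundedS c : poly_bounded c -> poly_bounded (fun b => (c b).+1).
Proof.
move=> H; apply: poly_bounded_le (poly_boundedD H (poly_bounded_const 1)) => b.
by rewrite addn1.
Qed.

Lemma poly_bounded_comp c d :
  poly_bounded c -> poly_bounded d -> poly_bounded (fun b => c (d b)).
Proof.
move=> [P H] [Q K]; exists (P \Po Q)%R => b; rewrite horner_comp.
by apply: leq_trans (H _) _; apply: horner_nat_mono.
Qed.

Lemma poly_bounded_sum (I : finType) (c : I -> nat -> nat) :
  (forall i, poly_bounded (c i)) -> poly_bounded (fun b => \sum_i c i b).
Proof.
move=> H; elim: (index_enum I) => [|i e IH].
  by apply: poly_bounded_le (poly_bounded_const 0) => b; rewrite big_nil.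
by apply: poly_bounded_le (poly_boundedD (H i) IH) => b; rewrite big_cons.
Qed.

#[local] Hint Resolve poly_bounded_const poly_bounded_id poly_boundedD
  poly_boundedM poly_boundedS : core.


(** * Games that encode binary constraints *)

Section ConflictGame.
Variables (alpha : rat) (K h : nat) (c : nat -> nat -> bool).
Hypotheses (alpha0 : (0 < alpha)%R) (alpha1 : (alpha < 1)%R).
Hypotheses (K0 : 0 < K) (h0 : 0 < h).

Definition clash (i j : nat) := (i %/ h != j %/ h) && (c i j || c j i).

Lemma clashC i j : clash i j = clash j i.
Proof. by rewrite /clash eq_sym orbC. Qed.

(** Some group has weight at least [1 / K], so with this entry [alpha * v] is at
    least [1 / (K * h)], a bound that does not depend on [alpha]. *)
Definition same_group_weight : rat := ((alpha * h%:R)^-1)%R.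

Lemma same_group_weight_gt0 : (0 < same_group_weight)%R.
Proof. by rewrite invr_gt0 mulr_gt0 // ltr0n. Qed.

Definition conflict_switching : 'M[rat]_(K * h) := (\matrix_(i, j) (clash i j)%:R)%R.

(** Each group owns [h] equal columns: then both matrices are square, and the
    number of vertices is also the number of columns. *)
Definition conflict_payoff : 'M[rat]_(K * h) :=
  (\matrix_(i, j) if (i %/ h == j %/ h)%N then same_group_weight else 0)%R.

Fact conflict_size_gt0 : 0 < K * h. Proof. by rewrite muln_gt0 K0. Qed.

Fact conflict_switching_sym : (conflict_switching^T = conflict_switching)%R.
Proof. by apply/matrixP => i j; rewrite !mxE clashC. Qed.

Fact conflict_switching_diag (i : 'I_(K * h)) : conflict_switching i i = 0%R.
Proof. by rewrite mxE /clash eqxx. Qed.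

Fact conflict_switching_ge0 (i j : 'I_(K * h)) : i != j -> (0 <= conflict_switching i j)%R.
Proof. by rewrite mxE ler0n. Qed.

Fact conflict_payoff_ge0 (i j : 'I_(K * h)) : (0 <= conflict_payoff i j)%R.
Proof. by rewrite mxE; case: ifP => // _; apply/ltW/same_group_weight_gt0. Qed.

Definition conflict_game : game :=
  Game conflict_size_gt0 conflict_size_gt0 conflict_switching_sym
    conflict_switching_diag conflict_switching_ge0 conflict_payoff_ge0.

Fact conflict_bound_ge0 : (0 <= (K * h)%:R^-1 :> rat)%R.
Proof. by rewrite invr_ge0 ler0n. Qed.

Definition conflict_bound : {xi : rat | (0 <= xi)%R} :=
  exist (fun xi : rat => (0 <= xi)%R) _ conflict_bound_ge0.

Lemma group_card g : g < K -> #|[pred j : 'I_(K * h) | j %/ h == g]| = h.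
Proof.
move=> gK.
have lt (r : 'I_h) : g * h + r < K * h.
  apply: (@leq_trans (g.+1 * h)); last by rewrite leq_mul2r gK orbT.
  by rewrite mulSn addnC ltn_add2r.
pose f r : 'I_(K * h) := Ordinal (lt r).
have fi : injective f by move=> r r' [] /addnI/val_inj.
rewrite -[RHS]card_ord -(card_codom fi); apply: eq_card => j; rewrite !inE.
apply/eqP/codomP => [e|[r ->]]; last by rewrite /= divnMDl // divn_small // addn0.
exists (Ordinal (ltn_pmod j h0)); apply: val_inj; rewrite /= -e.
exact: divn_eq.
Qed.

Local Open Scope ring_scope.
Variable R : realType.
Notation ca := (ratr alpha : R).
Notation n := (K * h)%N.

Let ca0 : 0 < ca. Proof. by rewrite ltr0q. Qed.
Let ca1 : ca < 1. Proof. by rewrite -[1](rmorph1 (@ratr R)) ltr_rat. Qed.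

Lemma column_payoff (x : 'cV[R]_n) (j : 'I_n) :
  (x^T *m map_mx ratr conflict_payoff *m (delta_mx j 0 : 'cV[R]_n)) 0 0 =
  (ca * h%:R)^-1 * \sum_(k < n | (k %/ h == j %/ h)%N) x k 0.
Proof.
rewrite -colE !mxE mulr_sumr [RHS]big_mkcond /=; apply: eq_bigr => k _.
rewrite !mxE; case: ifP => _; last by rewrite rmorph0 mulr0.
by rewrite /same_group_weight fmorphV rmorphM /= ratr_nat mulrC.
Qed.

Lemma switching_cost (x : 'cV[R]_n) :
  (x^T *m map_mx ratr conflict_switching *m x) 0 0 =
  \sum_(i < n) \sum_(j < n) (clash i j)%:R * (x i 0 * x j 0).
Proof.
rewrite mxE exchange_big /=; apply: eq_bigr => j _.
rewrite !mxE mulr_suml; apply: eq_bigr => i _.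
by rewrite !mxE ratr_nat; ring.
Qed.

(** Each entry of [x] is counted once for each of the [h] vertices of its
    group. *)
Lemma sum_groups (x : 'cV[R]_n) :
  \sum_(j < n) \sum_(k < n | (k %/ h == j %/ h)%N) x k 0 =
  h%:R * \sum_(k < n) x k 0.
Proof.
under eq_bigr do rewrite big_mkcond; rewrite exchange_big mulr_sumr /=.
apply: eq_bigr => k _; rewrite -big_mkcond /= sumr_const mulr_natl.
congr (_ *+ _); have kK : (k %/ h < K)%N by rewrite ltn_divLR.
by rewrite -[RHS](group_card kK); apply: eq_card => j; rewrite !inE /= eq_sym.
Qed.

(** The columns of the payoff matrix sum to [1 / alpha] against [x], so the
    largest of them is at least [1 / (alpha * K * h)]. A solution within the bound
    makes all columns equal to this value, which forces every group to carry
    weight, and makes the switching cost vanish, which forces the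
    support of [x] to be free of conflicts: any choice of a vertex of the
    support in each group will do. *)
Lemma conflict_gameP :
  yes (d := decision_version (switching_game_problem R alpha))
    (conflict_game, conflict_bound) <->
  exists a : nat -> nat, (forall g, (g < K)%N -> (a g < h)%N) /\
    forall g g', (g < K)%N -> (g' < K)%N -> g != g' ->
      ~~ c (g * h + a g) (g' * h + a g').
Proof.
have n0 : (n%:R : R) != 0 by rewrite pnatr_eq0 -lt0n conflict_size_gt0.
have K0' : (K%:R : R) != 0 by rewrite pnatr_eq0 -lt0n.
have h0' : (h%:R : R) != 0 by rewrite pnatr_eq0 -lt0n.
have caN : ca != 0 by rewrite gt_eqF.
have bnd : ratr (val conflict_bound) = n%:R^-1 :> R by rewrite /= fmorphV /= ratr_nat.
split.
- case=> -[x v] [Fv F1 F0] obj.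
  have {}obj : (1 - ca) * (x^T *m map_mx ratr conflict_switching *m x) 0 0 + ca * v
      <= n%:R^-1 by rewrite -bnd.
  rewrite switching_cost in obj.
  pose load (j : 'I_n) := (ca * h%:R)^-1 * \sum_(k < n | (k %/ h == j %/ h)%N) x k 0.
  have load_le j : load j <= v by rewrite /load -column_payoff; apply: Fv.
  have sum_load : \sum_j load j = ca^-1.
    by rewrite -mulr_sumr sum_groups F1 mulr1 invfM mulfVK.
  have term_ge0 (i j : 'I_n) : 0 <= (clash i j)%:R * (x i 0 * x j 0) :> R.
    by rewrite mulr_ge0 ?ler0n ?mulr_ge0.
  set Q := \sum_(i < n) _ in obj.
  have Q0 : 0 <= Q by apply: sumr_ge0 => i _; apply: sumr_ge0.
  have nv : ca^-1 <= n%:R * v.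
    by rewrite -sum_load mulr_natl -[n in v *+ n]card_ord -sumr_const ler_sum.
  have cav : n%:R^-1 <= ca * v.
    rewrite -(ler_pM2l (_ : 0 < n%:R)); last by rewrite ltr0n conflict_size_gt0.
    by rewrite mulfV // mulrCA -[leLHS](mulfV caN) ler_pM2l.
  have ca1' : 0 < 1 - ca by rewrite subr_gt0.
  have Qz : Q = 0.
    apply/eqP; rewrite eq_le Q0 andbT -(pmulr_rle0 _ ca1').
    by rewrite -(lerD2r (ca * v)) add0r (le_trans obj).
  have vE : n%:R * v = ca^-1.
    apply: le_anti; rewrite nv andbT -(ler_pM2l ca0) mulfV // mulrCA.
    rewrite -[leRHS](mulfV n0) ler_pM2l ?ltr0n ?conflict_size_gt0 //.
    by apply: le_trans obj; rewrite Qz mulr0 add0r.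
  have v0 : 0 < v.
    by rewrite -(pmulr_rgt0 _ (_ : 0 < n%:R)) ?vE ?invr_gt0 // ltr0n conflict_size_gt0.
  (* No column exceeds [v] and their average is [v]. *)
  have loadE j : load j = v.
    apply/eqP; rewrite -subr_eq0 -oppr_eq0 opprB.
    have : \sum_j (v - load j) == 0.
      by rewrite sumrB sumr_const card_ord -mulr_natl vE sum_load subrr.
    rewrite psumr_eq0 => [/allP/(_ j)|i _]; last by rewrite subr_ge0.
    by apply; rewrite mem_index_enum.
  have pick g : (g < K)%N -> exists k : 'I_n, (k %/ h == g)%N && (0 < x k 0).
    move=> gK; have lt : (g * h < n)%N by rewrite ltn_mul2r h0.
    have := loadE (Ordinal lt); rewrite /load /= mulnK // => e.
    apply/existsP; apply: contraTT v0; rewrite negb_exists => /forallP no.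
    rewrite -e big1 ?mulr0 ?ltxx // => k kg.
    by have := no k; rewrite kg /= lt0r F0 andbT negbK => /eqP.
  pose a g := if [pick k : 'I_n | (k %/ h == g)%N && (0 < x k 0)] is Some k
    then (k %% h)%N else 0%N.
  have aP g : (g < K)%N -> exists k : 'I_n, [/\ (k %/ h = g)%N, (k %% h = a g)%N & 0 < x k 0].
    move=> /pick [k kP]; rewrite /a; case: pickP => [k' /andP[/eqP k'g xk']|/(_ k)].
      by exists k'.
    by rewrite kP.
  exists a; split=> [g /aP[k [_ <- _]]|g g' /aP[k [kg ka xk]] /aP[k' [kg' ka' xk']] ne].
    by rewrite ltn_mod.
  have := Qz; rewrite /Q => /eqP; rewrite psumr_eq0; last by move=> i _; apply: sumr_ge0.
  move=> /allP/(_ k (mem_index_enum _)) /=; rewrite psumr_eq0 //.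
  move=> /allP/(_ k' (mem_index_enum _)) /=.
  rewrite !mulf_eq0 (gt_eqF xk) (gt_eqF xk') !orbF pnatr_eq0 eqb0 /clash kg kg' ne /=.
  have <- : (g * h + a g)%N = k by rewrite -ka -kg -divn_eq.
  have <- : (g' * h + a g')%N = k' by rewrite -ka' -kg' -divn_eq.
  by rewrite negb_or => /andP[].
case=> a [ah ac].
pose x : 'cV[R]_n := \col_i (if (i %% h == a (i %/ h))%N then K%:R^-1 else 0).
have div_ok (i : 'I_n) : (i %/ h < K)%N by rewrite ltn_divLR.
have xgroup (j : 'I_n) : \sum_(k < n | (k %/ h == j %/ h)%N) x k 0 = K%:R^-1.
  have lt : ((j %/ h) * h + a (j %/ h) < n)%N.
    apply: (@leq_trans ((j %/ h).+1 * h)); last by rewrite leq_mul2r div_ok orbT.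
    by rewrite mulSn addnC ltn_add2r ah.
  rewrite (bigD1 (Ordinal lt)) /=; last first.
    by rewrite divnMDl // (divn_small (ah _ (div_ok j))) addn0.
  rewrite big1 ?addr0; last first.
    move=> k /andP[/eqP kj ne]; rewrite mxE kj; case: eqP => // e; case/eqP: ne.
    by apply: val_inj; rewrite /= -e -kj -divn_eq.
  by rewrite mxE /= divnMDl // (divn_small (ah _ (div_ok j))) addn0 modnMDl
    (modn_small (ah _ (div_ok j))) eqxx.
have x0 (i : 'I_n) : 0 <= x i 0 by rewrite mxE; case: ifP; rewrite ?invr_ge0 ?ler0n.
exists (x, (ca * n%:R)^-1).
  split=> // [i|].
    by rewrite column_payoff xgroup -invfM natrM mulrA mulrAC.
  apply: (mulfI h0'); rewrite -sum_groups.
  under eq_bigr do rewrite xgroup.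
  by rewrite sumr_const card_ord -[LHS]mulr_natl natrM mulr1 mulrAC mulfV // mul1r.
suff : (1 - ca) * (x^T *m map_mx ratr conflict_switching *m x) 0 0
    + ca * (ca * n%:R)^-1 <= n%:R^-1 by rewrite -bnd.
rewrite switching_cost big1 ?mulr0 ?add0r.
  by rewrite invfM mulrA mulfV // mul1r.
move=> i _; apply: big1 => j _; rewrite ![x _ _]mxE.
case: ifP => [/eqP ei|]; last by rewrite mul0r mulr0.
case: ifP => [/eqP ej|]; last by rewrite !mulr0.
rewrite /clash; case: eqP => [|/eqP ne] //=; first by rewrite mul0r.
have := ac _ _ (div_ok i) (div_ok j) ne; rewrite -ei -ej -!divn_eq => /negbTE->.
rewrite eq_sym in ne.
have := ac _ _ (div_ok j) (div_ok i) ne; rewrite -ei -ej -!divn_eq => /negbTE->.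
by rewrite mul0r.
Qed.

End ConflictGame.

(** * Computations as solutions of binary constraints *)

Lemma run_halted (M : machine) (c : config M) t : Defs.next c = None -> run t c = c.
Proof. by move=> e; elim: t => //= t ->; rewrite e. Qed.

Lemma run_after_halt (M : machine) (c : config M) t t' :
  t <= t' -> Defs.next (run t c) = None -> run t' c = run t c.
Proof. by move=> /subnK <- e; rewrite /run iterD; apply: run_halted. Qed.

Section Tableau.
Variable M : machine.
Notation sym := (symbol (work_symbol M)).
Notation reg := 'I_(ntapes M).+1.
Notation row := {ffun reg -> sym}.

(** The cell at distance [p]: state of the machine, symbols under the heads, and
    for every tape the entries of index [p] of its two lists. The first two
    components are repeated in all the cells of a given time: this is what
    turns the transition rule, which looks at all heads at once, into a
    constraint between two cells. *)
Definition cell : finType := (state M * row * (row * row))%type.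

Implicit Types d : cell.
Definition ctl d : state M * row := d.1.
Definition lcell d : row := d.2.1.
Definition rcell d : row := d.2.2.

Definition next_state (qs : state M * row) : state M :=
  if step qs.1 qs.2 is Some (q, _) then q else qs.1.

Definition next_act (qs : state M * row) (i : reg) : sym * direction :=
  if step qs.1 qs.2 is Some (_, act) then act i else (qs.2 i, Stay).

Definition halts (qs : state M * row) : bool :=
  if step qs.1 qs.2 is None then true else false.

Definition wtape : reg := inord 1.

(** The tape of the witness may hold any word within the length bound; that its
    bits are contiguous is a constraint between neighbours, in [bad_pair]. *)
Definition bad_witness (in_bound : bool) (a : sym) : bool :=
  match a with
  | None => false
  | Some (inl _) => ~~ in_bound
  | Some (inr _) => true
  end.

Definition bad_start (wp : option bool) (in_bound : bool) d : bool :=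
  [|| (ctl d).1 != start M, [exists i, lcell d i != None],
      rcell d ord0 != omap inl wp, bad_witness in_bound (rcell d wtape)
    | [exists i : reg, (1 < i) && (rcell d i != None)]].

(** Acceptance is required of every cell of a halting configuration, whatever its
    time: the verifier halts before the horizon, so one such configuration
    occurs. *)
Definition bad_cell (t0 p0 : bool) (wp : option bool) (in_bound : bool) d : bool :=
  [|| p0 && (rcell d != (ctl d).2),
      halts (ctl d) && ((ctl d).2 ord0 != Some (inl true))
    | t0 && bad_start wp in_bound d].

(** [l] and [r] are the entries of index [p] of a tape before the step, [l'] and
    [r'] those of index [p'] after it; [same], [after] and [before] stand for
    [p' = p], [p' = p.+1] and [p = p'.+1]. *)
Definition bad_tape (p0 same after before : bool) (a : sym) (dir : direction)
    (l r l' r' : sym) : bool :=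
  let u := if p0 then a else r in
  match dir with
  | Stay => same && ((l' != l) || (r' != u))
  | Right => [|| [&& p0, same & l' != a], after && (l' != l) | before && (r' != u)]
  | Left => [|| before && (l' != l), [&& p0, same & r' != l] | after && (r' != u)]
  end.

(** [now] and [later] say that the second cell belongs to the same time as the
    first, respectively to the next one. *)
Definition bad_pair (t0 p0 now later same after before : bool) d d' : bool :=
  [|| now && (ctl d != ctl d'),
      [&& now, t0, after, rcell d wtape == None & rcell d' wtape != None]
    | later && (((ctl d').1 != next_state (ctl d)) ||
        [exists i, bad_tape p0 same after before (next_act (ctl d) i).1
           (next_act (ctl d) i).2 (lcell d i) (rcell d i) (lcell d' i) (rcell d' i)])].

Variables (w : bits) (T Q : nat).

Definition bad_at t p d := bad_cell (t == 0) (p == 0) (onth w p) (p < Q) d.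

Definition bad_between t p d t' p' d' :=
  bad_pair (t == 0) (p == 0) (t == t') (t' == t.+1) (p == p') (p' == p.+1)
    (p == p'.+1) d d'.

Definition tableau (D : nat -> nat -> cell) : Prop :=
  (forall t p, t < T -> p < T -> ~~ bad_at t p (D t p)) /\
  (forall t p t' p', t < T -> p < T -> t' < T -> p' < T ->
    (t, p) != (t', p') -> ~~ bad_between t p (D t p) t' p' (D t' p')).

(** ** One step of the machine, cell by cell *)

Definition cfg y t := run t (init M [:: w; y]).

Definition cell_at (c : config M) (p : nat) : cell :=
  (c.1, [ffun i => read (c.2 i)],
   ([ffun i => nth None (c.2 i).1 p], [ffun i => nth None (c.2 i).2 p])).

Lemma lcell_at c p i : lcell (cell_at c p) i = nth None (c.2 i).1 p.
Proof. by rewrite ffunE. Qed.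

Lemma rcell_at c p i : rcell (cell_at c p) i = nth None (c.2 i).2 p.
Proof. by rewrite ffunE. Qed.

Lemma cell_at0 c : rcell (cell_at c 0) = (ctl (cell_at c 0)).2.
Proof. by apply/ffunP => i; rewrite !ffunE nth0. Qed.

Lemma nth_keep (t : tape (work_symbol M)) p :
  nth None (read t :: behead t.2) p = nth None t.2 p.
Proof. by case: t => l [|a r] //=; case: p => //= p; rewrite nth_nil. Qed.

Lemma cfg_step y t p :
  let c := cell_at (cfg y t) p in
  (cfg y t.+1).1 = next_state (ctl c) /\
  forall i p', let tp := move (next_act (ctl c) i).2
                 (write (next_act (ctl c) i).1 ((cfg y t).2 i)) in
    nth None ((cfg y t.+1).2 i).1 p' = nth None tp.1 p' /\
    nth None ((cfg y t.+1).2 i).2 p' = nth None tp.2 p'.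
Proof.
rewrite /cfg /run iterS -/(run t _); set c := run t _.
rewrite /next_state /next_act /= /Defs.next.
case: (step _ _) => [[q act]|] /=; first by split=> // i p'; rewrite !ffunE.
by split=> // i p'; rewrite !ffunE nth_keep.
Qed.

(** The negation of [bad_tape], as equations between symbols. *)
Definition moved_cells (p0 same after before : bool) (a : sym) (dir : direction)
    (l r l' r' : sym) : Prop :=
  let u := if p0 then a else r in
  match dir with
  | Stay => same -> l' = l /\ r' = u
  | Right => [/\ p0 && same -> l' = a, after -> l' = l & before -> r' = u]
  | Left => [/\ before -> l' = l, p0 && same -> r' = l & after -> r' = u]
  end.

Lemma bad_tapeP p0 same after before a dir l r l' r' :
  ~~ bad_tape p0 same after before a dir l r l' r' <->
  moved_cells p0 same after before a dir l r l' r'.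
Proof.
have bP (b : bool) (x y : sym) : reflect (b -> x = y) (~~ (b && (x != y))).
  by case: b; rewrite /= ?negbK; [apply: (iffP eqP) => // /(_ isT) | left].
rewrite /bad_tape /moved_cells; case: dir; rewrite ?andbA.
- rewrite !negb_or; split=> [/and3P[/bP ? /bP ? /bP ?] // | [? ? ?]].
  by apply/and3P; split; apply/bP.
- rewrite andb_orr negb_or; split=> [/andP[/bP H /bP K] s | H]; first by split; auto.
  by apply/andP; split; apply/bP => /H[].
- rewrite !negb_or; split=> [/and3P[/bP ? /bP ? /bP ?] // | [? ? ?]].
  by apply/and3P; split; apply/bP.
Qed.

Lemma move_cells (tp : tape (work_symbol M)) a dir p p' :
  let tp' := move dir (write a tp) in
  moved_cells (p == 0) (p == p') (p' == p.+1) (p == p'.+1) a dir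
    (nth None tp.1 p) (nth None tp.2 p) (nth None tp'.1 p') (nth None tp'.2 p').
Proof.
case: tp => l r; rewrite /write /=.
have wr q : nth None (a :: behead r) q = if q == 0 then a else nth None r q.
  by case: q => //= q; rewrite nth_behead.
case: dir => /=.
- by split=> [/eqP->|/andP[/eqP-> /eqP<-]|/eqP->] /=; rewrite ?nth_behead ?nth0 ?wr.
- by move=> /eqP<-; split=> //; rewrite wr.
- by split=> [/andP[/eqP-> /eqP<-]|/eqP->|/eqP->] /=; rewrite ?nth_behead.
Qed.

(** The entry of index [p'] after a move is determined by the entries of index at
    most [p'.+1] before it. *)
Lemma moved_cells_move (tp : tape (work_symbol M)) a dir p' l' r'
   (lc rc : nat -> sym) n : p'.+1 < n ->
   (forall p, p < n -> lc p = nth None tp.1 p) ->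
   (forall p, p < n -> rc p = nth None tp.2 p) ->
   (forall p, p < n -> moved_cells (p == 0) (p == p') (p' == p.+1) (p == p'.+1)
      a dir (lc p) (rc p) l' r') ->
  let tp' := move dir (write a tp) in
  l' = nth None tp'.1 p' /\ r' = nth None tp'.2 p'.
Proof.
move=> ltn lcE rcE; case: tp lcE rcE => l r /= lcE rcE ok; rewrite /write.
have pn : p' < n by apply: ltnW.
have wr q : nth None (a :: behead r) q = if q == 0 then a else nth None r q.
  by case: q => //= q; rewrite nth_behead.
case: dir ok => ok /=.
- have [Hl _ _] := ok _ ltn; rewrite nth_behead Hl // lcE //; split=> //.
  case: p' ltn pn ok {Hl} => [|p'] ltn pn ok /=.
    by have [_ -> // _] := ok 0 pn; rewrite lcE // nth0.
  by have [_ _ -> //] := ok p' (ltnW pn); rewrite wr rcE // ltnW.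
- by have [] := ok _ pn (eqxx _); rewrite wr lcE // rcE.
- split; last first.
    by have [_ _ -> //] := ok _ ltn; rewrite nth_behead rcE.
  case: p' ltn pn ok => [|p'] ltn pn ok /=; first by have [-> //] := ok 0 pn.
  by have [_ -> // _] := ok p' (ltnW pn); rewrite lcE // ltnW.
Qed.

Hypothesis two_tapes : 0 < ntapes M.

Lemma val_wtape : wtape = 1 :> nat.
Proof. by rewrite inordK // ltnS. Qed.

Variable V : bits -> bool.
Hypothesis T_gt1 : 1 < T.
Hypothesis decides : forall y, size y <= Q ->
  exists2 t, t < T & computes_within M [:: w; y] [:: V y] t.

Lemma cfg_halts y t t' : halts (ctl (cell_at (cfg y t) 0)) ->
  computes_within M [:: w; y] [:: V y] t' -> output (cfg y t) = [:: V y].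
Proof.
move=> h [h' <-]; have {}h : Defs.next (cfg y t) = None.
  by move: h; rewrite /halts /Defs.next /=; case: (step _ _).
congr output; case/orP: (leq_total t t') => le.
  by symmetry; apply: run_after_halt le h.
by apply: run_after_halt le h'.
Qed.

Lemma output_head c b : output c = [:: b] :> bits ->
  (ctl (cell_at c 0)).2 ord0 = Some (inl b).
Proof.
by rewrite /output /= !ffunE /read; case: (c.2 ord0).2 => [|[[?|?]|] ?] //= [->].
Qed.

Lemma nth_init y i p : nth None ((init M [:: w; y]).2 i).2 p =
  omap inl (onth (nth [::] [:: w; y] i) p).
Proof.
rewrite ffunE /=; move: (nth [::] _ _) => u.
by elim: u p => [|b u IH] [|p] //=; rewrite IH.
Qed.

(** All constraints are local but acceptance, which holds because the halting
    configurations of a run are all the same, with output [V y]. *)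
Lemma tableau_of_witness y : size y <= Q -> V y ->
  tableau (fun t p => cell_at (cfg y t) p).
Proof.
move=> yQ Vy; split=> [t p tT pT|t p t' p' tT pT t'T p'T ne].
  rewrite /bad_at /bad_cell !negb_or !negb_and; apply/and3P; split.
  - by case: eqP => //= ->; rewrite cell_at0 eqxx.
  - case: (boolP (halts _)) => //= h; rewrite negbK; apply/eqP; apply: output_head.
    have [t' _ C] := decides yQ; rewrite -Vy; exact: cfg_halts h C.
  - case: eqP => //= ->; rewrite /bad_start !negb_or eqxx /= !negb_exists.
    apply/and4P; split.
    + by apply/forallP => i; rewrite lcell_at ffunE /= nth_nil.
    + by rewrite rcell_at nth_init eqxx.
    + rewrite rcell_at nth_init val_wtape /=; case: (ltnP p (size y)) => py.
        case: (onth y p) (onthTE y p) => //= b _; rewrite negbK.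
        exact: leq_trans yQ.
      by rewrite onth_default.
    + apply/forallP => i; apply/nandP; case: ltnP => i1; [right | by left].
      rewrite rcell_at nth_init; move: i1; case: (nat_of_ord i) => [|[|j]] //= _; by rewrite nth_nil onth0n.
rewrite /bad_between /bad_pair !negb_or; apply/and3P; split.
- by rewrite negb_and negbK; case: (eqVneq t t') => //= ->.
- apply/negP => /and5P[/eqP <- /eqP -> /eqP ->]; rewrite !rcell_at !nth_init.
  rewrite val_wtape [nth _ _ _]/= => /eqP e; rewrite onth_default //.
  by apply: leqW; rewrite -onthNE; case: (onth y p) e.
rewrite negb_and; case: eqP => //= ->.
have [-> H] := cfg_step y t p; rewrite eqxx /=; apply/existsPn => i.
apply/bad_tapeP; have [h1 h2] := H i p'.
by rewrite !lcell_at !rcell_at h1 h2; apply: move_cells.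
Qed.

Lemma leading_bitsE (u : seq sym) :
  (forall p, if nth None u p is Some (inr _) then False else True) ->
  (forall p, nth None u p = None -> nth None u p.+1 = None) ->
  forall p, nth None u p = omap inl (onth (leading_bits u) p).
Proof.
elim: u => [|a u IH] H K p; first by rewrite nth_nil /= onth0n.
have := H 0; case: a H K => [[b|a]|] H K //= _; last first.
  have N q : nth None (None :: u) q = None by elim: q => //= q /K.
  by rewrite N onth0n.
case: p => [//|p] /=; apply: (IH (fun p => H p.+1) (fun p => K p.+1)).
Qed.

(** The witness is read off the cells of time 0. By induction on the time,
    the constraints then leave no freedom except near the far end of the tapes, and
    the run is over before that freedom can be noticed by the heads. *)
Lemma witness_of_tableau D : tableau D -> exists2 y, size y <= Q & V y.
Proof.
move=> [H1 H2]; have T0 : 0 < T by apply: ltnW.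
pose u := [seq rcell (D 0 p) wtape | p <- iota 0 T].
have uE p : p < T -> nth None u p = rcell (D 0 p) wtape.
  by move=> pT; rewrite (nth_map 0) ?size_iota // nth_iota.
have uT p : T <= p -> nth None u p = None.
  by move=> ?; rewrite nth_default // size_map size_iota.
have start p : p < T -> ~~ bad_start (onth w p) (p < Q) (D 0 p).
  by move=> /(H1 _ _ T0); rewrite /bad_at /bad_cell !negb_or => /and3P[].
pose y : bits := leading_bits u.
have yE : forall p, nth None u p = omap inl (onth y p).
  apply: leading_bitsE => p; case: (ltnP p T) => pT; try by rewrite ?uT // leqW.
    rewrite uE //; have := start _ pT; rewrite /bad_start !negb_or.
    by case/and5P=> _ _ _; case: (rcell _ _) => [[]|].
  case: (ltnP p.+1 T) => pT'; last by move=> _; apply: uT.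
  rewrite !uE // => e.
  have := H2 0 p 0 p.+1 T0 pT T0 pT'; rewrite xpair_eqE /= (ltn_eqF (ltnSn p)).
  move=> /(_ isT); rewrite /bad_between /bad_pair !eqxx /= e eqxx /= !negb_or.
  by case/and3P => _; rewrite negbK => /eqP.
have yQ : size y <= Q.
  rewrite leqNgt; apply/negP => lt.
  have := yE Q; case: (onth y Q) (onthTE y Q); rewrite ?lt // => b _ /= e.
  case: (ltnP Q T) => QT; last by rewrite uT in e.
  have := start _ QT; rewrite ltnn /bad_start !negb_or.
  by rewrite -uE // e => /and5P[].
exists y => //; have [tau tT C] := decides yQ.
have ctlE t p : t < T -> p < T -> ctl (D t p) = ctl (D t 0).
  move=> tT' pT; case: (eqVneq p 0) => [-> //|p0].
  have := H2 t p t 0 tT' pT tT' T0; rewrite xpair_eqE eqxx /= p0 => /(_ isT).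
  by rewrite /bad_between /bad_pair eqxx /= !negb_or negbK => /and3P[/eqP].
(* The cell of index [T.-1] has no neighbour on its right, so arbitrary symbols
   may enter there and advance by one cell per step: hence [p + t < T]. *)
pose good t := (ctl (D t 0)).1 = (cfg y t).1 /\ forall p, p + t < T ->
  lcell (D t p) = lcell (cell_at (cfg y t) p) /\
  rcell (D t p) = rcell (cell_at (cfg y t) p).
have good_ctl t : t < T -> good t -> ctl (D t 0) = ctl (cell_at (cfg y t) 0).
  move=> tT' [e /(_ 0)]; rewrite add0n => /(_ tT') [_ rE].
  have := H1 t 0 tT' T0; rewrite /bad_at /bad_cell !negb_or /= negbK.
  case/and3P=> /eqP r0 _ _; rewrite [LHS]surjective_pairing e -r0 rE.
  by rewrite cell_at0.
have main t : t < T -> good t.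
  elim: t => [|t IH] tT'.
    split.
      have := start _ T0; rewrite /bad_start !negb_or negbK.
      by case/and5P => /eqP.
    move=> p; rewrite addn0 => pT; have := start _ pT.
    rewrite /bad_start !negb_or; case/and5P => _ l0 /negPn r0 _ r2.
    split; apply/ffunP => i.
      rewrite lcell_at ffunE nth_nil; apply/eqP.
      by have := existsPn l0 i; rewrite negbK.
    rewrite rcell_at nth_init; case: (eqVneq i ord0) => [->|i0].
      by rewrite (eqP r0).
    case: (eqVneq i wtape) => [->|i1]; first by rewrite -uE // yE val_wtape.
    have i2 : 1 < i.
      move: i0 i1; rewrite -!val_eqE /= val_wtape; case: (nat_of_ord i) => [|[|]] //.
    have := existsPn r2 i; rewrite i2 /= negbK => /eqP->.
    by case: (nat_of_ord i) i2 => [|[|j]] //= _; rewrite nth_nil onth0n.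
  have G := IH (ltnW tT'); have C0 := good_ctl _ (ltnW tT') G; have [_ cells] := G.
  have [sE tapes] := cfg_step y t 0.
  have succ p p' : p < T -> p' < T ->
      (ctl (D t.+1 p')).1 = next_state (ctl (D t 0)) /\
      forall i, moved_cells (p == 0) (p == p') (p' == p.+1) (p == p'.+1)
        (next_act (ctl (D t 0)) i).1 (next_act (ctl (D t 0)) i).2
        (lcell (D t p) i) (rcell (D t p) i)
        (lcell (D t.+1 p') i) (rcell (D t.+1 p') i).
    move=> pT p'T; have := H2 t p t.+1 p' (ltnW tT') pT tT' p'T.
    rewrite xpair_eqE (ltn_eqF (ltnSn t)) => /(_ isT).
    rewrite /bad_between /bad_pair eqxx ctlE ?(ltnW tT') //= !negb_or.
    case/and3P => _ _ /andP[/negPn/eqP ? /existsPn H]; split=> // i.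
    exact/bad_tapeP.
  split; first by rewrite sE -C0; have [] := succ 0 0 T0 T0.
  move=> p' p'T; have p'T' : p' < T by apply: leq_ltn_trans p'T; apply: leq_addr.
  suff E i : lcell (D t.+1 p') i = lcell (cell_at (cfg y t.+1) p') i /\
             rcell (D t.+1 p') i = rcell (cell_at (cfg y t.+1) p') i.
    by split; apply/ffunP => i; have [] := E i.
  rewrite lcell_at rcell_at; have [-> ->] := tapes i p'; rewrite -C0.
  apply: (@moved_cells_move _ _ _ p' _ _ (fun p => lcell (D t p) i)
    (fun p => rcell (D t p) i) (T - t)).
  - by move: p'T; clear; lia.
  - move=> p pt; have [|-> _] := cells p; first by rewrite addnC -ltn_subRL.
    exact: lcell_at.
  - move=> p pt; have [|_ ->] := cells p; first by rewrite addnC -ltn_subRL.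
    exact: rcell_at.
  - move=> p pt; have [] := succ p p' _ p'T'; last by move=> _; apply.
    by apply: leq_trans pt _; apply: leq_subr.
have e := good_ctl _ tT (main _ tT).
have : halts (ctl (D tau 0)).
  rewrite e; case: C => + _; rewrite /halts /Defs.next /= -/(cfg y tau).
  by case: (step _ _) => [[]|].
move=> h; have := H1 tau 0 tT T0; rewrite /bad_at /bad_cell h /= !negb_or negbK.
case/and3P => _ /eqP a _; move: a; rewrite e.
rewrite (output_head (cfg_halts _ C)) -?e // => /eqP.
by case: (V y).
Qed.

Lemma tableauP :
  (exists D, tableau D) <-> exists2 y, size y <= Q & V y.
Proof.
split=> [[D]|[y yQ Vy]]; first exact: witness_of_tableau.
by eexists; apply: tableau_of_witness yQ Vy.
Qed.

End Tableau.

(** * Numbering the vertices *)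

Lemma flatten_iotaM T (g : nat -> seq T) a b :
  flatten [seq g i | i <- iota 0 (a * b)] =
  flatten [seq flatten [seq g (x * b + y) | y <- iota 0 b] | x <- iota 0 a].
Proof.
elim: a => // a IH; rewrite -(addn1 a) iotaD [in RHS]map_cat flatten_cat /= cats0.
rewrite mulnDl mul1n iotaD map_cat flatten_cat IH; congr (_ ++ flatten _).
by rewrite add0n -[in LHS](addn0 (a * b)) iotaDl -map_comp.
Qed.

Lemma flatten_onth (u : bits) :
  flatten [seq oapp (fun b => [:: b]) [::] (onth u i) | i <- iota 0 (size u)] = u.
Proof.
elim: u => //= b u IH; congr cons; rewrite -[in RHS]IH; congr flatten.
by rewrite -[1]/(1 + 0) iotaDl -map_comp.
Qed.

Lemma encode_mxE n m (B : 'M[rat]_(n, m)) (g : nat -> nat -> bits) :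
  (forall i j, encode_rat (B i j) = g i j) ->
  encode_mx B = flatten [seq flatten [seq g i j | j <- iota 0 m] | i <- iota 0 n].
Proof.
move=> H; rewrite /encode_mx.
have -> : iota 0 n = map val (enum 'I_n) by rewrite val_enum_ord.
elim: (enum 'I_n) => //= i e IH; rewrite flatten_cat IH; congr (flatten _ ++ _).
rewrite -val_enum_ord -map_comp; exact: eq_map.
Qed.

Section Vertices.
Variables (A : finType) (a0 : A) (T : nat).
Notation h := #|A|.

Definition vertex (i : nat) : nat * nat * A :=
  (i %/ h %/ T, i %/ h %% T, nth a0 (enum A) (i %% h)).

Lemma vertexE t p d : p < T -> d < h ->
  vertex ((t * T + p) * h + d) = (t, p, nth a0 (enum A) d).
Proof.
move=> pT dh; have h0 : 0 < h by apply: leq_ltn_trans dh.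
have T0 : 0 < T by apply: leq_ltn_trans pT.
rewrite /vertex divnMDl // modnMDl (divn_small dh) (modn_small dh) addn0.
by rewrite divnMDl // modnMDl (divn_small pT) (modn_small pT) addn0.
Qed.

Lemma flatten_vertices (g : nat -> bits) (f : nat -> nat -> A -> bits) :
  (forall t p d, t < T -> p < T -> d < h ->
     g ((t * T + p) * h + d) = f t p (nth a0 (enum A) d)) ->
  flatten [seq g i | i <- iota 0 (T * T * h)] =
  flatten [seq flatten [seq flatten [seq f t p d | d <- enum A]
    | p <- iota 0 T] | t <- iota 0 T].
Proof.
move=> H; rewrite flatten_iotaM flatten_iotaM; congr flatten.
apply/eq_in_map => t; rewrite mem_iota => /andP[_ tT]; congr flatten.
apply/eq_in_map => p; rewrite mem_iota => /andP[_ pT]; congr flatten.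
rewrite -[in RHS](mkseq_nth a0 (enum A)) -map_comp /mkseq -cardE.
by apply/eq_in_map => d; rewrite mem_iota => /andP[_ dh]; apply: H.
Qed.

End Vertices.

(** * The reduction *)

Section Reduction.
Variables (R : realType) (alpha : rat).
Hypotheses (alpha0 : (0 < alpha)%R) (alpha1 : (alpha < 1)%R).
Variables (V : bits -> bits -> bool) (q : {poly nat}).
Variables (M : machine) (time : {poly nat}).
Hypothesis two_tapes : 0 < ntapes M.
Hypothesis decides : forall x y,
  computes_within M [:: x; y] [:: V x y] (time.[size x + size y])%R.

Notation cellM := (cell M).
Notation h := #|cellM|.

Definition cell0 : cellM := (start M, [ffun=> None], ([ffun=> None], [ffun=> None])).

Lemma cells_gt0 : 0 < h.
Proof. by apply/card_gt0P; exists cell0. Qed.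

(** Bounds on the length of the witness and on the number of steps; the horizon
    exceeds the running time and is at least two, so that there are two
    groups. *)
Definition wbound (w : bits) : nat := q.[size w]%R.
Definition horizon (w : bits) : nat := (time.[size w + wbound w]%R).+2.
Notation groups w := (horizon w * horizon w).

(** A bad cell conflicts with the vertices of all other groups, and cannot be
    chosen since there are other groups. *)
Definition conflict (w : bits) (i j : nat) : bool :=
  let: (t, p, d) := vertex cell0 (horizon w) i in
  let: (t', p', d') := vertex cell0 (horizon w) j in
  bad_at w (wbound w) t p d || bad_between t p d t' p' d'.

Lemma groups_gt0 w : 0 < groups w. Proof. by []. Qed.

Definition instance (w : bits) : dinst (decision_version (switching_game_problem R alpha)) :=
  (conflict_game (conflict w) alpha0 (groups_gt0 w) cells_gt0,
   conflict_bound (horizon w * horizon w) h).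

(** The tableau and the choice of a vertex in each group are the same data, up
    to the numbering of the vertices. *)
Lemma instanceP w :
  (exists2 y, size y <= wbound w & V w y) <->
  yes (d := decision_version (switching_game_problem R alpha)) (instance w).
Proof.
have dec y : size y <= wbound w ->
    exists2 t, t < horizon w & computes_within M [:: w; y] [:: V w y] t.
  move=> yQ; exists (time.[size w + size y]%R); last exact: decides.
  by rewrite ltnS leqW // horner_nat_mono // leq_add2l.
apply: iff_trans (iff_sym (tableauP two_tapes (isT : 1 < horizon w) dec)) _.
apply: iff_trans _ (iff_sym (conflict_gameP _ _ alpha1 _ _ _)).
set T := horizon w; have T0 : 0 < T by [].
split=> [[D [H1 H2]] | [a [ah H]]].
  pose a g := index (D (g %/ T) (g %% T)) (enum cellM).
  have ah g : a g < h by rewrite cardE index_mem mem_enum.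
  have vE g : vertex cell0 T (g * h + a g) = (g %/ T, g %% T, D (g %/ T) (g %% T)).
    by rewrite {1}(divn_eq g T) vertexE ?ltn_pmod // nth_index ?mem_enum.
  exists a; split=> [g _ | g g' gK g'K ne]; first exact: ah.
  rewrite /conflict !vE negb_or H1 ?ltn_pmod ?ltn_divLR //=.
  apply: H2; rewrite ?ltn_pmod ?ltn_divLR //.
  by apply: contraNneq ne => -[e1 e2]; rewrite (divn_eq g T) e1 e2 -divn_eq.
pose D t p : cellM := nth cell0 (enum cellM) (a (t * T + p)).
have lt t p : t < T -> p < T -> t * T + p < T * T.
  move=> tT pT; apply: (@leq_trans (t.+1 * T)); last by rewrite leq_mul2r tT orbT.
  by rewrite mulSn addnC ltn_add2r.
have main t p t' p' : t < T -> p < T -> t' < T -> p' < T -> (t, p) != (t', p') ->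
    ~~ (bad_at w (wbound w) t p (D t p) || bad_between t p (D t p) t' p' (D t' p')).
  move=> tT pT t'T p'T ne.
  have := H (t * T + p) (t' * T + p') (lt _ _ tT pT) (lt _ _ t'T p'T).
  rewrite /conflict !vertexE ?ah ?lt //; apply.
  apply: contraNneq ne => e.
  have := congr1 (divn^~ T) e; have := congr1 (modn^~ T) e.
  by rewrite /= !modnMDl !divnMDl // !modn_small // !divn_small // !addn0 => -> ->.
exists D; split=> [t p tT pT | t p t' p' tT pT t'T p'T ne].
  (* The cell at [p == 0], read as a number, lies in another group. *)
  have p'T : (p == 0) < T by case: (p == 0).
  have ne : (t, p) != (t, p == 0 : nat) by rewrite xpair_eqE eqxx /=; case: p {pT p'T}.
  by have := main _ _ _ _ tT pT tT p'T ne; rewrite negb_or => /andP[].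
by have := main _ _ _ _ tT pT t'T p'T ne; rewrite negb_or => /andP[].
Qed.

End Reduction.

(** * Stack programs on Turing machine tapes *)

Section StackPrograms.
Variable k : nat.

Notation reg := 'I_k.+1.
Notation sym := (symbol void).
Notation tapes := {ffun reg -> tape void}.
Notation store := (reg -> bits).

(** A machine with tapes [0, ..., k] that ends with a result in [V] instead of just
    halting; [inl] ends the program without moving the heads. *)
Record prog (V : Type) := Prog {
  pstate : finType;
  pstart : pstate;
  pstep : pstate -> {ffun reg -> sym} -> V + pstate * (reg -> sym * direction)
}.

Definition reads (ts : tapes) : {ffun reg -> sym} := [ffun i => read (ts i)].

Definition act_on (a : reg -> sym * direction) (ts : tapes) : tapes :=
  [ffun i => move (a i).2 (write (a i).1 (ts i))].

Section Reaches.
Variables (V : Type) (P : prog V).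

Inductive reaches : nat -> pstate P -> tapes -> pstate P -> tapes -> Prop :=
| reaches0 q ts : reaches 0 q ts q ts
| reachesS n q ts q1 a q2 ts2 :
    pstep q (reads ts) = inr (q1, a) ->
    reaches n q1 (act_on a ts) q2 ts2 -> reaches n.+1 q ts q2 ts2.

End Reaches.
Arguments reaches [V] P.

(** A tape is a stack whose top is under the head. The cells on the left of the
    head are arbitrary: a push overwrites them. Words on a tape in an
    initial configuration and the output of a machine have this shape. *)
Definition holds (t : tape void) (u : bits) :=
  exists j, t.2 = [seq Some (inl b) | b <- u] ++ nseq j None.

Definition holds_all (ts : tapes) (s : store) := forall i, holds (ts i) (s i).

Variant runs V (P : prog V) (s : store) (v : V) (s' : store) (m : nat) : Prop :=
  Runs of forall ts, holds_all ts s -> exists n q ts',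
    [/\ n <= m, reaches P n (pstart P) ts q ts',
        pstep q (reads ts') = inl v & holds_all ts' s'].

Definition upd (s : store) (r : reg) (u : bits) : store :=
  fun i => if i == r then u else s i.

Lemma upd_at s r u : upd s r u r = u.
Proof. by rewrite /upd eqxx. Qed.

Lemma upd_neq s r u i : i != r -> upd s r u i = s i.
Proof. by rewrite /upd => /negbTE->. Qed.

Lemma upd_same s r : upd s r (s r) = s.
Proof. by apply: funext => i; rewrite /upd; case: eqP => [->|]. Qed.

Lemma upd_upd s r u v : upd (upd s r u) r v = upd s r v.
Proof. by apply: funext => i; rewrite /upd; case: eqP. Qed.

Lemma updC s r r' u v : r != r' -> upd (upd s r u) r' v = upd (upd s r' v) r u.
Proof.
move=> /eqP n; apply: funext => i; rewrite /upd.
by case: eqP => [->|//]; case: eqP => // e; case: n.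
Qed.

Lemma upd_id s r u : s r = u -> upd s r u = s.
Proof. by move<-; apply: upd_same. Qed.

Lemma runs_le V (P : prog V) s v s' m m' :
  runs P s v s' m -> m <= m' -> runs P s v s' m'.
Proof.
case=> H le; split=> ts /H [n [q [ts' [ln ? ? ?]]]].
by exists n, q, ts'; split=> //; apply: leq_trans le.
Qed.

Lemma reaches_cat V (P : prog V) n m q ts q1 ts1 q2 ts2 :
  reaches P n q ts q1 ts1 -> reaches P m q1 ts1 q2 ts2 ->
  reaches P (n + m) q ts q2 ts2.
Proof. by elim=> // {}n q0 t0 q' a q'' t'' e _ IH /IH; apply: reachesS. Qed.

(** ** Reading and writing registers *)

(** The idle action; writing back a blank may lengthen the list of a tape, which
    is why [holds] allows blanks after the word. *)
Definition keep (s : {ffun reg -> sym}) : reg -> sym * direction :=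
  fun i => (s i, Stay).

Lemma holds_keep (t : tape void) u :
  holds t u -> holds (move Stay (write (read t) t)) u.
Proof.
case: t => l r [j /= ->]; case: u => [|b u] /=; last by exists j.
by case: j => [|j]; [exists 1 | exists j.+1].
Qed.

Lemma holds_all_keep ts s : holds_all ts s -> holds_all (act_on (keep (reads ts)) ts) s.
Proof. by move=> H i; rewrite !ffunE /= ?ffunE; apply: holds_keep. Qed.

Definition ret V (v : V) : prog V :=
  @Prog V (unit : finType) tt (fun _ _ => inl v).

Lemma runs_ret V (v : V) s : runs (ret v) s v s 0.
Proof. by split=> ts H; exists 0, tt, ts; split=> //; constructor. Qed.

Definition bit_of (a : sym) : option bool := if a is Some (inl b) then Some b else None.

Definition top (r : reg) : prog (option bool) :=
  @Prog _ (unit : finType) tt (fun _ s => inl (bit_of (s r))).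

Lemma bit_of_holds t u : holds t u -> bit_of (read t) = ohead u.
Proof. by rewrite /read => -[j ->]; case: u => //; case: j. Qed.

Lemma runs_top r s : runs (top r) s (ohead (s r)) s 0.
Proof.
split=> ts H; exists 0, tt, ts; split=> //; first by constructor.
by rewrite /= ffunE (bit_of_holds (H r)).
Qed.

Definition pop (r : reg) : prog unit :=
  @Prog _ (bool : finType) false (fun q s => if q then inl tt else
    inr (true, fun i => if i == r then (None, Right) else keep s i)).

Lemma runs_pop r s : runs (pop r) s tt (upd s r (behead (s r))) 1.
Proof.
split=> ts H; exists 1; do 2 eexists; split=> //.
- by econstructor; [reflexivity | constructor].
- by [].
- move=> i; rewrite !ffunE /upd; case: eqP => [->|_] /=.
    have [j e] := H r; exists (if s r is [::] then j.-1 else j).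
    by rewrite e; case: (s r) => //; case: j {e}.
  by rewrite ffunE; apply: holds_keep.
Qed.

(** Two steps: a head moves after it writes, so the move to the free cell
    comes first. *)
Definition push (r : reg) (b : bool) : prog unit :=
  @Prog _ (option bool : finType) None (fun q s =>
    match q with
    | None => inr (Some false, fun i => if i == r then (s i, Left) else keep s i)
    | Some false => inr (Some true, fun i =>
        if i == r then (Some (inl b), Stay) else keep s i)
    | Some true => inl tt
    end).

Lemma runs_push r b s : runs (push r b) s tt (upd s r (b :: s r)) 2.
Proof.
split=> ts H; exists 2; do 2 eexists; split=> //.
- by econstructor; [reflexivity | econstructor; [reflexivity|constructor]].
- by [].
- move=> i; rewrite /upd; case: (altP (i =P r)) => [->|ne].
    have [j /= e] := holds_keep (H r).
    by exists j; rewrite !ffunE eqxx /= e.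
  have := holds_keep (holds_keep (H i)).
  by rewrite !ffunE (negbTE ne) /= !ffunE (negbTE ne) /= !ffunE.
Qed.

(** ** Sequencing and iteration *)

(** One idle step is spent to pass from [P] to its continuation. *)
Definition bind (V : finType) W (P : prog V) (K : V -> prog W) : prog W :=
  @Prog W (pstate P + {v : V & pstate (K v)})%type (inl (pstart P))
   (fun q s => match q with
    | inl q1 => match pstep q1 s with
      | inl v => inr (inr (Tagged (fun v => pstate (K v)) (pstart (K v))), keep s)
      | inr (q2, a) => inr (inl q2, a)
      end
    | inr q1 => match pstep (tagged q1) s with
      | inl w => inl w
      | inr (q2, a) => inr (inr (Tagged (fun v => pstate (K v)) q2), a)
      end
    end).

Lemma bind_reaches_l (V : finType) W (P : prog V) (K : V -> prog W) n q ts q' ts' :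
  reaches P n q ts q' ts' -> reaches (bind P K) n (inl q) ts (inl q') ts'.
Proof.
elim=> [{}q t|{}n {}q t q1 a q2 t2 e _ IH]; first by constructor.
by apply: (@reachesS _ (bind P K)) IH; rewrite /= e.
Qed.

Lemma bind_reaches_r (V : finType) W (P : prog V) (K : V -> prog W) v n q ts q' ts' :
  reaches (K v) n q ts q' ts' ->
  reaches (bind P K) n (inr (Tagged (fun v => pstate (K v)) q)) ts
    (inr (Tagged (fun v => pstate (K v)) q')) ts'.
Proof.
elim=> [{}q t|{}n {}q t q1 a q2 t2 e _ IH]; first by constructor.
by apply: (@reachesS _ (bind P K)) IH; rewrite /= e.
Qed.

Lemma runs_bind (V : finType) W (P : prog V) (K : V -> prog W) s v s1 w s2 m1 m2 :
  runs P s v s1 m1 -> runs (K v) s1 w s2 m2 ->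
  runs (bind P K) s w s2 (m1 + m2).+1.
Proof.
case=> H1 [H2]; split=> ts /H1 [n1 [q1 [ts1 [l1 r1 e1 h1]]]].
have [n2 [q2 [ts2 [l2 r2 e2 h2]]]] := H2 _ (holds_all_keep h1).
exists (n1 + n2.+1), (inr (Tagged (fun v => pstate (K v)) q2)), ts2; split=> //.
- by rewrite addnS ltnS leq_add.
- apply: reaches_cat (bind_reaches_l K r1) _.
  by apply: (@reachesS _ (bind P K)) (bind_reaches_r P r2); rewrite /= e1.
- by rewrite /= e2.
Qed.

(** [None] asks for another round, which is entered by an idle step. *)
Definition loop (W : Type) (P : prog (option W)) : prog W :=
  @Prog W (pstate P) (pstart P)
   (fun q s => match pstep q s with
    | inl None => inr (pstart P, keep s)
    | inl (Some w) => inl w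
    | inr x => inr x
    end).

Lemma loop_reaches W (P : prog (option W)) n q ts q' ts' :
  reaches P n q ts q' ts' -> reaches (loop P) n q ts q' ts'.
Proof.
elim=> [{}q t|{}n {}q t q1 a q2 t2 e _ IH]; first by constructor.
by apply: (@reachesS _ (loop P)) IH; rewrite /= e.
Qed.

Lemma runs_loop_exit W (P : prog (option W)) s w s' m :
  runs P s (Some w) s' m -> runs (loop P) s w s' m.
Proof.
case=> H; split=> ts /H [n [q [ts' [l r e h]]]]; exists n, q, ts'; split=> //.
  exact: loop_reaches.
by rewrite /= e.
Qed.

Lemma runs_loop_again W (P : prog (option W)) s s1 w s' m1 m2 :
  runs P s None s1 m1 -> runs (loop P) s1 w s' m2 ->
  runs (loop P) s w s' (m1 + m2).+1.
Proof.
case=> H1 [H2]; split=> ts /H1 [n1 [q1 [ts1 [l1 r1 e1 h1]]]].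
have [n2 [q2 [ts2 [l2 r2 e2 h2]]]] := H2 _ (holds_all_keep h1).
exists (n1 + n2.+1), q2, ts2; split=> //.
- by rewrite addnS ltnS leq_add.
- apply: reaches_cat (loop_reaches r1) _.
  by apply: (@reachesS _ (loop P)) r2; rewrite /= e1.
Qed.

(** Each step lengthens the list right of a head by at most two cells, so
    the space used by a program is bounded by its running time. *)
Lemma runs_size V (P : prog V) s v s' m r :
  runs P s v s' m -> size (s' r) <= size (s r) + m.*2.
Proof.
pose ts : tapes := [ffun i => ([::], [seq Some (inl b) | b <- s i])].
have h : holds_all ts s by move=> i; exists 0; rewrite ffunE cats0.
case=> /(_ ts h) [n [q [ts' [le R _ /(_ r) [j e]]]]].
suff : size (ts' r).2 <= size (ts r).2 + n.*2.
  rewrite e size_cat [ts r]ffunE !size_map; move: le; lia.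
elim: R => [*|{e le}n0 q0 t q1 a q2 t2 _ _]; first by rewrite addn0.
rewrite ffunE => /leq_trans; apply.
case: (a r) => x [] /=; rewrite ?size_behead; case: (t r).2 => [|? ?] /=; lia.
Qed.

(** ** From programs to machines *)

Definition machine_of V (P : prog V) : machine :=
  @Machine (pstate P) (void : finType) k (pstart P)
    (fun q s => if pstep q s is inr x then Some x else None).

(** The machine keeps its configuration once it has halted, so any larger time is
    as good. *)
Lemma machine_computes V (P : prog V) (u : bits) v s' m :
  runs P (upd (fun=> [::]) ord0 u) v s' m ->
  forall t, m <= t -> computes_within (machine_of P) [:: u] (s' ord0) t.
Proof.
set s := upd _ _ _; case=> H t mt.
have h : holds_all (init (machine_of P) [:: u]).2 s.
  move=> i; exists 0; rewrite cats0 ffunE /s /upd /=.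
  by case: eqP => [->//|]; case: i => -[|[|i]] //= il; case; apply: val_inj.
have [n [q [ts' [nm R e h']]]] := H _ h.
have E : run n (init (machine_of P) [:: u]) = (q, ts').
  rewrite [init _ _]surjective_pairing /=.
  move: R; rewrite /=; elim=> [//|{e h' nm}n0 q0 t0 q1 a q2 t2 e _ IH].
  by rewrite /run iterSr /= {2}/Defs.next /= -/(reads t0) e; apply: IH.
have N : Defs.next (run n (init (machine_of P) [:: u])) = None.
  by rewrite E /Defs.next /= -/(reads ts') e.
rewrite /computes_within (run_after_halt (leq_trans nm mt) N); split=> //.
rewrite E /output /=; have [j ->] := h' ord0.
by elim: (s' ord0) => [|b l /= ->] //; case: j.
Qed.

End StackPrograms.

(** * A library of stack programs *)

Notation "v <- P ;; Q" := (bind P (fun v => Q))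
  (at level 61, P at next level, right associativity).
Notation "P ;; Q" := (bind P (fun _ => Q))
  (at level 61, right associativity).

(** Decides the tests between registers that come from unfolding [upd]. *)
Ltac upd_case :=
  rewrite /upd;
  repeat (match goal with
  | H : is_true (?a != ?a) |- _ => by move: H; rewrite eqxx
  | |- context [@eq_op ?T ?a ?a] => rewrite (@eqxx T a)
  | H : is_true (?a != ?b) |- context [@eq_op ?T ?a ?b] => rewrite (negbTE H)
  | H : is_true (?a != ?b) |- context [@eq_op ?T ?b ?a] =>
      rewrite (@eq_sym T b a) (negbTE H)
  | |- context [@eq_op ?T ?a ?b] => change (@eq_op T a b) with false
  | |- context [@eq_op ?T ?a ?b] => case: (@eqVneq T a b) => [?|?]; subst
  end); rewrite //=.

Ltac store_eq := apply: funext => i; upd_case.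

Section Macros.
Variable k : nat.
Notation reg := 'I_k.+1.
Notation store := (reg -> bits).
Implicit Types (s : store) (x y r o : reg).

Lemma runs_eq V (P : prog k V) s v v' s1 s2 m m' :
  runs P s v s1 m -> v = v' -> s1 = s2 -> m <= m' -> runs P s v' s2 m'.
Proof. by move=> H <- <-; apply: runs_le. Qed.

Definition each x (body : bool -> prog k unit) : prog k unit :=
  loop (h <- top x ;;
        if h is Some b then pop x ;; body b ;; ret k None else ret k (Some tt)).

(** The second hypothesis says that [body] neither reads nor writes [x], so that
    consuming [x] along the way does not interfere with the fold. *)
Lemma runs_each x body (f : bool -> store -> store) m s :
  (forall b s, runs (body b) s tt (f b s) m) ->
  (forall b s u, f b (upd s x u) = upd (f b s) x u) ->
  runs (each x body) s tt (upd (foldl (fun s b => f b s) s (s x)) x [::])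
    (size (s x) * (m + 5) + 1).
Proof.
move=> H comm; move e: (s x) => u; elim: u s e => [|b u IH] s e.
  have -> : upd (foldl (fun s b => f b s) s [::]) x [::] = s by rewrite /= upd_id.
  apply: runs_loop_exit; apply: runs_le (_ : 1 <= _); last by rewrite mul0n.
  by apply: (runs_bind (m2 := 0) (runs_top x s)); rewrite e; apply: runs_ret.
have -> : size (b :: u) * (m + 5) + 1 = (m + 4 + (size u * (m + 5) + 1)).+1.
  rewrite /=; lia.
apply: runs_loop_again.
  apply: runs_le (_ : (0 + (1 + (m + 0).+1).+1).+1 <= _); last by clear; lia.
  apply: runs_bind (runs_top x s) _; rewrite e /=.
  apply: runs_bind (runs_pop _ _) _; apply: runs_bind (H b _) _.
  exact: runs_ret.
rewrite e /= comm.
have := IH (upd (f b s) x u); rewrite upd_at => /(_ erefl).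
have fcomm t v w : foldl (fun s b => f b s) (upd t x v) w =
    upd (foldl (fun s b => f b s) t w) x v.
  by elim: w t => //= c w IHw t; rewrite comm IHw.
by rewrite fcomm upd_upd.
Qed.

Definition transfer x y : prog k unit := each x (fun b => push y b).

Lemma runs_transfer x y s : x != y ->
  runs (transfer x y) s tt (upd (upd s y (catrev (s x) (s y))) x [::])
    (size (s x) * 7 + 1).
Proof.
move=> xy.
have := @runs_each x _ (fun b s => upd s y (b :: s y)) 2 s
  (fun b s => runs_push y b s).
have -> : forall u s, foldl (fun s b => upd s y (b :: s y)) s u =
    upd s y (catrev u (s y)).
  elim=> [|b u IH] t /=; first by rewrite upd_same.
  by rewrite IH upd_upd upd_at.
by apply=> b t u; rewrite updC ?(upd_neq _ _ (i := y)) // eq_sym.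
Qed.

Definition clear x : prog k unit := each x (fun _ => ret k tt).

Lemma runs_clear x s :
  runs (clear x) s tt (upd s x [::]) (size (s x) * 5 + 1).
Proof.
have := @runs_each x _ (fun b s => s) 0 s (fun b s => runs_ret tt s).
have -> : forall u s, foldl (fun s _ => s) s u = s by move=> A u; elim: u.
by apply.
Qed.

Fixpoint pushes o (u : bits) : prog k unit :=
  if u is b :: u' then push o b ;; pushes o u' else ret k tt.

Lemma runs_pushes o u s :
  runs (pushes o u) s tt (upd s o (catrev u (s o))) (size u * 3).
Proof.
elim: u s => [|b u IH] s /=; first by rewrite upd_same; apply: runs_ret.
have -> : (size u).+1 * 3 = (2 + size u * 3).+1 by lia.
apply: runs_bind (runs_push _ _ _) _.
by have := IH (upd s o (b :: s o)); rewrite upd_at upd_upd.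
Qed.

(** ** Random access

   A register doubles as the index given by its length; [ta] and [tb] are
   scratch registers. *)

Variables ta tb : reg.
Hypothesis tab : ta != tb.

(** The symbols of [x] and as many symbols of [r] are moved to the scratch
    registers; the answer is kept in the control while they are moved back. *)
Definition lookup r x : prog k (option bool) :=
  each x (fun b => push ta b ;; h <- top r ;;
    if h is Some c then pop r ;; push tb c else ret k tt) ;;
  h <- top r ;; transfer ta x ;; transfer tb r ;; ret k h.

Lemma ohead_drop T i (u : seq T) : ohead (drop i u) = onth u i.
Proof. by elim: u i => [|a u IH] [|i] //=; rewrite -IH. Qed.

Lemma runs_lookup r x s : uniq [:: r; x; ta; tb] -> s ta = [::] -> s tb = [::] ->
  runs (lookup r x) s (onth (s r) (size (s x))) s (40 * (size (s x)).+1).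
Proof.
move=> U sa sb.
have [rx ra rb xa xb] : [/\ r != x, r != ta, r != tb, x != ta & x != tb].
  by move: U; rewrite /= !inE !negb_or; case/and4P => /and3P[-> -> ->] /andP[-> ->].
pose f b s := upd (upd (upd s ta (b :: s ta)) r (behead (s r))) tb
  (if s r is c :: _ then c :: s tb else s tb).
have F u t : foldl (fun s b => f b s) t u =
   upd (upd (upd t ta (catrev u (t ta))) r (drop (size u) (t r))) tb
     (catrev (take (size u) (t r)) (t tb)).
  elim: u t => [|b u IH] t /=; first by rewrite drop0 take0 /= !upd_same.
  by rewrite IH /f /=; store_eq; case: (t r).
have E b t : runs (push ta b ;; h <- top r ;;
    if h is Some c then pop r ;; push tb c else ret k tt) t tt (f b t) 9.
  apply: runs_le (_ : (2 + (0 + 5).+1).+1 <= _) => //.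
  apply: runs_bind (runs_push _ _ _) _; apply: runs_bind (runs_top _ _) _.
  rewrite /f upd_neq //; case e: (t r) => [|c w] /=.
    by apply: runs_eq (runs_ret _ _) _ _ _ => //; store_eq.
  apply: runs_le (_ : (1 + 2).+1 <= _) => //.
  apply: runs_bind (runs_pop _ _) _.
  by apply: runs_eq (runs_push _ _ _) _ _ _ => //; store_eq; rewrite e.
have C b t u : f b (upd t x u) = upd (f b t) x u by rewrite /f; store_eq.
have R := runs_each s E C; rewrite F in R.
pose n := size (s x).
apply: runs_le (_ : (n * 14 + 1 + (0 + (n * 7 + 1 + (n * 7 + 1 + 0).+1).+1).+1).+1 <= _);
  last by rewrite -/n; move: n; clear; lia.
apply: runs_bind R _; apply: runs_bind (runs_top _ _) _.
apply: runs_bind.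
  apply: runs_eq (runs_transfer _ _) erefl erefl _; first by rewrite eq_sym.
  by upd_case; rewrite sa catrevE cats0 size_rev.
apply: runs_bind.
  apply: runs_eq (runs_transfer _ _) erefl erefl _; first by rewrite eq_sym.
  by upd_case; rewrite sb catrevE cats0 size_rev size_take; case: ltnP => // le; rewrite leq_add2r leq_mul2r.
apply: runs_eq (runs_ret _ _) _ _ _ => //.
  by upd_case; rewrite ohead_drop.
store_eq; rewrite ?sa ?sb ?catrevE ?cats0 ?revK ?cat_take_drop //.
Qed.

(** The register [x] as the number [i]: the bottom symbol differs from the
    others, so that one access to position [i] of the counter [j] tells
    [i.+1 < j], [i.+1 = j] and [j <= i] apart. *)
Fixpoint ctr (i : nat) : bits := if i is j.+1 then (0 < j) :: ctr j else [::].

Lemma size_ctr i : size (ctr i) = i.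
Proof. by elim: i => //= i ->. Qed.

Lemma onth_ctr j i : onth (ctr j) i = if i < j then Some (i.+1 < j) else None.
Proof. by elim: j i => [|j IH] [|i] //=; rewrite IH !ltnS. Qed.

Definition incr x : prog k unit :=
  h <- top x ;; push x (h != None).

Lemma runs_incr x s i : s x = ctr i -> runs (incr x) s tt (upd s x (ctr i.+1)) 3.
Proof.
move=> e; apply: runs_le (_ : (0 + 2).+1 <= _) => //.
apply: runs_bind (runs_top _ _) _; rewrite e.
by apply: runs_eq (runs_push _ _ _) _ _ _ => //; rewrite e; case: i {e}.
Qed.

(** ** Programs that print

   A printing program only appends to its output register [o], most recent
   symbol on top; its running time is bounded in terms of the lengths of the
   other registers alone, so that a loop over it has a bound of the same kind
   whatever it prints. The registers in [zs] are scratch and counters not in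
   use. *)

Definition ready o (zs : seq reg) (b : nat) s :=
  (forall r, r \in zs -> s r = [::]) /\ (forall r, r != o -> size (s r) <= b).

Definition insensitive (T : Type) o (f : store -> T) :=
  forall s u, f (upd s o u) = f s.

Definition prints o (zs : seq reg) (P : prog k unit) (f : store -> bits) :=
  insensitive o f /\
  exists c, poly_bounded c /\ forall s b, ready o zs b s ->
    runs P s tt (upd s o (catrev (f s) (s o))) (c b).

Definition probes V o (zs : seq reg) (P : prog k V) (g : store -> V) :=
  insensitive o g /\
  exists c, poly_bounded c /\ forall s b, ready o zs b s -> runs P s (g s) s (c b).

Lemma ready_upd o zs b s u : o \notin zs -> ready o zs b s -> ready o zs b (upd s o u).
Proof.
move=> oz [H K]; split=> r rz; last by rewrite upd_neq //; apply: K.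
by rewrite upd_neq ?H //; apply: contraNneq oz => <-.
Qed.

Lemma probes_ret V o zs (v : V) : probes o zs (ret k v) (fun=> v).
Proof.
split=> //; exists (fun=> 0); split; first exact: poly_bounded_const.
by move=> s b _; apply: runs_ret.
Qed.

Lemma probes_bind (V : finType) W o zs (P : prog k V) (K : V -> prog k W) g h f :
  probes o zs P g -> (forall v, probes o zs (K v) (h v)) ->
  (forall s, h (g s) s = f s) -> probes o zs (bind P K) f.
Proof.
move=> [ig [c [pc HP]]] H /funext<-.
have [d Hd] := fin_all_exists (fun v => (H v).2).
split=> [s u|]; first by rewrite ig (H _).1.
exists (fun b => (c b + \sum_v d v b).+1); split.
  apply: poly_boundedS; apply: poly_boundedD => //.
  by apply: poly_bounded_sum => v; case: (Hd v).
move=> s b rs; apply: runs_bind (HP _ _ rs) _.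
apply: runs_le ((Hd _).2 _ _ rs) _.
by rewrite (bigD1 (g s)) //= leq_addr.
Qed.

Lemma prints_bind (V : finType) o zs (P : prog k V) (K : V -> prog k unit) g f :
  probes o zs P g -> (forall v, prints o zs (K v) (f v)) ->
  prints o zs (bind P K) (fun s => f (g s) s).
Proof.
move=> [ig [c [pc HP]]] H.
have [d Hd] := fin_all_exists (fun v => (H v).2).
split=> [s u|]; first by rewrite ig (H _).1.
exists (fun b => (c b + \sum_v d v b).+1); split.
  apply: poly_boundedS; apply: poly_boundedD => //.
  by apply: poly_bounded_sum => v; case: (Hd v).
move=> s b rs; apply: runs_bind (HP _ _ rs) _.
apply: runs_le ((Hd _).2 _ _ rs) _.
by rewrite (bigD1 (g s)) //= leq_addr.
Qed.

Lemma probes_top o zs r : r != o -> probes o zs (top r) (fun s => ohead (s r)).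
Proof.
move=> ro; split=> [s u|]; first by rewrite upd_neq.
exists (fun=> 0); split; first exact: poly_bounded_const.
by move=> s b _; apply: runs_top.
Qed.

Lemma probes_lookup o zs r x :
  uniq [:: r; x; ta; tb] -> ta \in zs -> tb \in zs -> r != o -> x != o ->
  probes o zs (lookup r x) (fun s => onth (s r) (size (s x))).
Proof.
move=> U az bz ro xo; split=> [s u|]; first by rewrite !upd_neq.
exists (fun b => 40 * b.+1); split.
  by apply: poly_boundedM => //; apply: poly_boundedS.
move=> s b [z l]; apply: runs_le (runs_lookup U (z _ az) (z _ bz)) _.
by rewrite leq_mul2l /= ltnS; apply: l.
Qed.

Lemma prints_pushes o zs u : prints o zs (pushes o u) (fun=> u).
Proof.
split=> //; exists (fun=> size u * 3); split; first exact: poly_bounded_const.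
by move=> s b _; apply: runs_pushes.
Qed.

Lemma prints_seq o zs P Q f g : o \notin zs ->
  prints o zs P f -> prints o zs Q g ->
  prints o zs (P ;; Q) (fun s => f s ++ g s).
Proof.
move=> oz [If [c [pc H]]] [Ig [d [pd K]]]; split=> [s u|]; first by rewrite If Ig.
exists (fun b => (c b + d b).+1); split; first by auto.
move=> s b rs; apply: runs_bind (H _ _ rs) _.
apply: runs_eq (K _ _ (ready_upd _ oz rs)) _ _ _ => //.
by rewrite upd_upd upd_at Ig catrev_catl.
Qed.

Lemma prints_foldr (T : Type) o zs (P : T -> prog k unit) f (e : seq T) : o \notin zs ->
  (forall a, prints o zs (P a) (f a)) ->
  prints o zs (foldr (fun a Q => P a ;; Q) (ret k tt) e)
    (fun s => flatten [seq f a s | a <- e]).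
Proof.
move=> oz H; elim: e => [|a e IH] /=; last exact: prints_seq.
split=> //; exists (fun=> 0); split; first exact: poly_bounded_const.
by move=> s b _; rewrite /= upd_same; apply: runs_ret.
Qed.

Definition for_ x r (P : prog k unit) : prog k unit :=
  loop (h <- lookup r x ;;
        if h is Some _ then P ;; incr x ;; ret k None else ret k (Some tt)) ;;
  clear x.

(** The counter [x] serves both as loop variable and, through [lookup], as the test
    for the end of the loop. Neither depends on what has been printed, so each
    of the at most [b] rounds has the same bound. *)
Lemma prints_for o zs x r P f :
  uniq [:: r; x; ta; tb] -> ta \in zs -> tb \in zs -> r != o -> x != o ->
  o \notin zs -> x \notin zs ->
  prints o zs P f ->
  prints o (x :: zs) (for_ x r P)
    (fun s => flatten [seq f (upd s x (ctr i)) | i <- iota 0 (size (s r))]).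
Proof.
move=> U az bz ro xo oz xz [If [c [pc H]]]; split=> [s u|].
  rewrite upd_neq //; congr flatten; apply: eq_map => i.
  by rewrite updC 1?eq_sym // If.
exists (fun b => (b * (c b + 40 * b.+1 + 10) + 40 * b.+1 + b * 5 + 5)); split.
  by repeat (apply: poly_boundedD || apply: poly_boundedM || apply: poly_boundedS
    || apply: pc || apply: poly_bounded_id || apply: poly_bounded_const).
move=> s b [z l].
have sx : s x = [::] by apply: z; rewrite mem_head.
have rx : r != x by move: U; rewrite /= inE negb_or => /andP[/andP[]].
set n := size (s r).
have nb : n <= b by apply: l.
have step i w : i <= n -> ready o zs b (upd (upd s x (ctr i)) o w).
  move=> le; apply: ready_upd => //; split=> [r' r'z|r' r'o].
    rewrite upd_neq ?z ?in_cons ?r'z ?orbT //.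
    by apply: contraNneq xz => <-.
  rewrite /upd; case: eqP => _; last exact: l.
  by rewrite size_ctr (leq_trans le).
have look i w : i <= n -> runs (lookup r x) (upd (upd s x (ctr i)) o w)
    (onth (s r) i) (upd (upd s x (ctr i)) o w) (40 * b.+1).
  move=> le; have [z' l'] := step i w le.
  apply: runs_eq (runs_lookup U (z' _ az) (z' _ bz)) _ _ _ => //.
    by upd_case; rewrite size_ctr.
  by rewrite leq_mul2l /= ltnS; apply: l'.
have main d i w : i + d = n ->
  runs (loop (h <- lookup r x ;;
        if h is Some _ then P ;; incr x ;; ret k None else ret k (Some tt)))
    (upd (upd s x (ctr i)) o w) tt
    (upd (upd s x (ctr n)) o
       (catrev (flatten [seq f (upd s x (ctr i)) | i <- iota i d]) w))
    (d * (c b + 40 * b.+1 + 9) + 40 * b.+1 + 1).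
  elim: d i w => [|d IH] i w e.
    rewrite addn0 in e; rewrite e /=; apply: runs_loop_exit.
    apply: runs_le (_ : (40 * b.+1 + 0).+1 <= _); last by clear; lia.
    apply: runs_bind (look _ _ _) _ => //.
    by rewrite onth_default //; apply: runs_ret.
  have lt : i < n by rewrite -e addnS ltnS leq_addr.
  have -> : d.+1 * (c b + 40 * b.+1 + 9) + 40 * b.+1 + 1 =
    ((40 * b.+1 + (c b + (3 + 0).+1).+1).+1 + 2
     + (d * (c b + 40 * b.+1 + 9) + 40 * b.+1 + 1)).+1.
    by clear; rewrite mulSn; lia.
  apply: runs_loop_again.
    apply: runs_le (_ : (40 * b.+1 + (c b + (3 + 0).+1).+1).+1 <= _); last by clear; lia.
    apply: runs_bind (look _ _ (ltnW lt)) _.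
    have : onth (s r) i by rewrite onthTE.
    case: (onth (s r) i) => // a _.
    apply: runs_bind (H _ _ (step _ _ (ltnW lt))) _; rewrite upd_at upd_upd If.
    apply: runs_bind; last exact: runs_ret.
    by apply: (@runs_incr _ _ i); rewrite upd_neq // upd_at.
  rewrite updC 1?eq_sym // upd_upd.
  apply: runs_eq (IH i.+1 _ _) _ _ _ => //; first by rewrite -e addSnnS.
  by rewrite catrev_catl.
have := main n 0 (s o) (add0n _); rewrite /= -{1}sx !upd_same => R.
apply: runs_le (_ : (n * (c b + 40 * b.+1 + 9) + 40 * b.+1 + 1
   + (n * 5 + 1)).+1 <= _); last first.
  apply: (@leq_trans (b * (c b + 40 * b.+1 + 10) + 40 * b.+1 + b * 5 + 3)).
    have : n * (c b + 40 * b.+1 + 9) <= b * (c b + 40 * b.+1 + 10).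
      by rewrite leq_mul // leq_add2l.
    by move: nb; clear; lia.
  by clear; lia.
apply: runs_bind R _.
apply: runs_eq (runs_clear _ _) _ _ _ => //.
  by store_eq.
by upd_case; rewrite size_ctr.
Qed.

End Macros.

(** * Binary codes *)

Lemma digitsE n : 0 < n -> digits n = odd n :: digits n./2.
Proof.
move=> n0; rewrite /digits up_log2S //.
rewrite /mkseq /= expn0 divn1; congr cons.
rewrite -[1]/(1 + 0) iotaDl -map_comp; apply: eq_map => i /=.
by rewrite expnS divnMA divn2.
Qed.

Lemma encode_natE n : 0 < n -> encode_nat n = [:: true, odd n & encode_nat n./2].
Proof. by move=> n0; rewrite /encode_nat digitsE. Qed.

Lemma encode_rat_inv n : 0 < n ->
  encode_rat (n%:R^-1)%R = (encode_int 1 ++ [:: false]) ++ encode_nat n.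
Proof.
move=> n0; have nz : (Posz n != 0)%R by rewrite eqz_nat -lt0n.
have den : denq (n%:R^-1)%R = Posz n by rewrite -[(n%:R)%R]/((Posz n)%:~R)%R denqVz.
have num : numq (n%:R^-1)%R = 1%R.
  apply: (@intr_inj rat); rewrite numqE den mulVf //.
  by rewrite pnatr_eq0 -lt0n.
by rewrite /encode_rat num den -catA.
Qed.


(** * Programs run on a family of stores *)

Section Families.
Variable k : nat.
Notation reg := 'I_k.+1.
Notation store := (reg -> bits).
Notation family := (bits -> reg -> bits).

Definition bounded (st : family) :=
  exists c, poly_bounded c /\ forall w r, size (st w r) <= c (size w).

(** The stores of a family are indexed by the input, and costs are measured in
    its length; polynomial bounds on the initial contents of the registers
    are all that a program may rely on. *)
Variant computes (P : prog k unit) (st st' : family) : Prop :=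
  Computes of bounded st -> exists c, poly_bounded c /\
    forall w, runs P (st w) tt (st' w) (c (size w)).

(** What is written takes time. *)
Lemma computes_bounded P st st' : computes P st st' -> bounded st -> bounded st'.
Proof.
move=> [C] B; have [c [pc H]] := C B; have [d [pd K]] := B.
exists (fun n => d n + c n * 2); split.
  by apply: poly_boundedD => //; apply: poly_boundedM => //; apply: poly_bounded_const.
move=> w r; apply: leq_trans (runs_size _ (H w)) _.
by rewrite muln2 leq_add2r.
Qed.

Lemma computes_seq P Q st st1 st2 :
  computes P st st1 -> computes Q st1 st2 -> computes (P ;; Q) st st2.
Proof.
move=> C [D]; split=> B; have [c [pc H]] := let: Computes C' := C in C' B.
have [d [pd K]] := D (computes_bounded C B).
exists (fun n => (c n + d n).+1); split; first by auto.
by move=> w; apply: runs_bind (H w) (K w).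
Qed.

Lemma computes_eq P st st1 st2 :
  computes P st st1 -> (forall w, st1 w = st2 w) -> computes P st st2.
Proof. by move=> C e; have -> : st2 = st1 by apply: funext => w. Qed.

Lemma computes_ret st : computes (ret k tt) st st.
Proof.
split=> _; exists (fun=> 0); split; first exact: poly_bounded_const.
by move=> w; apply: runs_ret.
Qed.

Lemma computes_prints o zs P f st :
  prints o zs P f -> (forall w r, r \in zs -> st w r = [::]) ->
  computes P st (fun w => upd (st w) o (catrev (f (st w)) (st w o))).
Proof.
move=> [_ [c [pc H]]] z; split=> -[d [pd K]]; exists (fun n => c (d n)); split.
  exact: poly_bounded_comp.
by move=> w; apply: H; split=> r; [apply: z | move=> _; apply: K].
Qed.

Lemma computes_clear x st : computes (clear x) st (fun w => upd (st w) x [::]).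
Proof.
split=> -[d [pd K]]; exists (fun n => d n * 5 + 1); split.
  by apply: poly_boundedD; [apply: poly_boundedM|]; auto.
by move=> w; apply: runs_le (runs_clear _ _) _; rewrite leq_add2r leq_mul2r K.
Qed.

Lemma computes_transfer x y st : x != y ->
  computes (transfer x y) st
    (fun w => upd (upd (st w) y (catrev (st w x) (st w y))) x [::]).
Proof.
move=> xy; split=> -[d [pd K]]; exists (fun n => d n * 7 + 1); split.
  by apply: poly_boundedD; [apply: poly_boundedM|]; auto.
by move=> w; apply: runs_le (runs_transfer _ xy) _; rewrite leq_add2r leq_mul2r K.
Qed.

Lemma computes_pushes o u st :
  computes (pushes o u) st (fun w => upd (st w) o (catrev u (st w o))).
Proof.
by apply: computes_prints (prints_pushes o [::] u) _.
Qed.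

(** ** Unary evaluation of a polynomial, by Horner's rule *)

Lemma catrev_nseq T n m (a : T) : catrev (nseq n a) (nseq m a) = nseq (n + m) a.
Proof.
rewrite catrevE; have -> : rev (nseq n a) = nseq n a.
  elim: n => //= n IH; rewrite rev_cons IH.
  by rewrite -[RHS]/(nseq n.+1 a) -addn1 nseqD cats1.
by rewrite -nseqD.
Qed.

Lemma catrev_nseq0 T n (a : T) : catrev (nseq n a) [::] = nseq n a.
Proof. by rewrite -[[::]]/(nseq 0 a) catrev_nseq addn0. Qed.

Lemma flatten_nseq1 n T (a : T) m :
  flatten [seq nseq m a | _ <- iota 0 n] = nseq (n * m) a.
Proof. by elim: n 0 => //= n IH i; rewrite IH mulSn nseqD. Qed.

Section Horner.
Variables base acc z x y ta tb : reg.
Hypothesis U : uniq [:: base; acc; z; x; y; ta; tb].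

(** [acc] holds the value of the coefficients treated so far, in unary; it is
    multiplied by the length of [base] with two nested loops that print the
    product to [z]. *)
Fixpoint eval_poly (s : seq nat) : prog k unit :=
  if s is a :: s' then
    eval_poly s' ;; for_ ta tb x acc (for_ ta tb y base (pushes z [:: true])) ;;
    clear acc ;; transfer z acc ;; pushes acc (nseq a true)
  else ret k tt.

Local Ltac distinct :=
  rewrite /= ?inE ?negb_or ?eqxx ?orbT //=;
  repeat (apply/andP; split); rewrite //; by rewrite eq_sym.

Local Ltac split_uniq :=
  move: (U); rewrite /= !inE !negb_or -!andbA; do 21 case/andP => ?; move=> _.

Lemma prints_product : prints z [:: x; y; ta; tb]
  (for_ ta tb x acc (for_ ta tb y base (pushes z [:: true])))
  (fun s => nseq (size (s acc) * size (s base)) true).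
Proof.
split_uniq; have tab : ta != tb by [].
have I := @prints_for k ta tb tab z [:: ta; tb] y base _ _ _ _ _ _ _ _ _
  (prints_pushes z [:: ta; tb] [:: true]).
have O := @prints_for k ta tb tab z [:: y; ta; tb] x acc _ _ _ _ _ _ _ _ _ (I _ _ _ _ _ _ _).
set f := (fun s => nseq _ _).
have -> : f = (fun s => flatten [seq flatten [seq [:: true] | _ <-
    iota 0 (size (upd s x (ctr i) base))] | i <- iota 0 (size (s acc))]).
  apply: funext => s; rewrite /f -flatten_nseq1; congr flatten.
  apply: eq_map => i; rewrite upd_neq //.
  by have := flatten_nseq1 (size (s base)) true 1; rewrite muln1 => <-.
by apply: O; distinct.
Qed.

Lemma computes_eval_poly (s : seq nat) st :
  (forall w r, r \in [:: acc; z; x; y; ta; tb] -> st w r = [::]) ->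
  computes (eval_poly s) st
    (fun w => upd (st w) acc (nseq (horner_rec s (size (st w base))) true)).
Proof.
split_uniq => E; have tab : ta != tb by [].
elim: s => [|a s IH] /=.
  apply: computes_eq (computes_ret st) _ => w.
  by rewrite upd_id // E ?mem_head.
apply: computes_seq IH _; apply: computes_seq.
  apply: computes_prints prints_product _ => w r rz.
  have ra : r != acc by apply: contraTneq rz => ->; distinct.
  by rewrite /= upd_neq // E // in_cons in_cons rz !orbT.
apply: computes_seq (computes_clear acc _) _.
apply: computes_seq (computes_transfer _ _) _; first by distinct.
apply: computes_eq (computes_pushes _ _ _) _ => w.
have Ez : st w z = [::] by apply: E; distinct.
have {E}Eacc : st w acc = [::] by apply: E; distinct.
by store_eq; rewrite Ez !catrev_nseq0 catrev_nseq size_nseq addnC.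
Qed.
End Horner.

(** ** From unary to binary, by repeated halving *)

Section Binary.
Variables x y e : reg.
Hypotheses (xy : x != y) (xe : x != e) (ye : y != e).

Definition halve : prog k bool :=
  loop (h <- top x ;;
    if h is Some _ then
      pop x ;; h' <- top x ;;
      if h' is Some _ then pop x ;; push y true ;; ret k None
      else ret k (Some true)
    else ret k (Some false)).

Lemma runs_halve n s : s x = nseq n true ->
  runs halve s (odd n)
    (upd (upd s x [::]) y (nseq n./2 true ++ s y)) (n.+1 * 10).
Proof.
elim/ltn_ind: n s => -[|[|n]] IH s /= sx.
- apply: runs_loop_exit; apply: runs_le (_ : (0 + 0).+1 <= _) => //.
  apply: runs_bind (runs_top _ _) _; rewrite sx /=.
  by apply: runs_eq (runs_ret _ _) _ _ _ => //; store_eq.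
- apply: runs_loop_exit; apply: runs_le (_ : (0 + (1 + (0 + 0).+1).+1).+1 <= _) => //.
  apply: runs_bind (runs_top _ _) _; rewrite sx /=.
  apply: runs_bind (runs_pop _ _) _; apply: runs_bind (runs_top _ _) _.
  rewrite upd_at sx /=.
  by apply: runs_eq (runs_ret _ _) _ _ _ => //; store_eq; rewrite ?sx.
have -> : n.+3 * 10 = (19 + n.+1 * 10).+1 by lia.
apply: runs_loop_again.
  apply: runs_le (_ : (0 + (1 + (0 + (1 + (2 + 0).+1).+1).+1).+1).+1 <= _) => //.
  apply: runs_bind (runs_top _ _) _; rewrite sx /=.
  apply: runs_bind (runs_pop _ _) _; apply: runs_bind (runs_top _ _) _.
  rewrite upd_at sx /=.
  apply: runs_bind (runs_pop _ _) _; apply: runs_bind (runs_push _ _ _) _.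
  exact: runs_ret.
apply: runs_eq (IH n _ _ _) _ _ _ => //.
- by upd_case.
- by rewrite /= negbK.
- by store_eq; elim: n./2 => //= m ->.
Qed.

Definition to_binary : prog k unit :=
  loop (h <- top x ;;
    if h is Some _ then
      b <- halve ;; transfer y x ;; push e true ;; push e b ;; ret k None
    else ret k (Some tt)) ;;
  push e false.

(** Every round costs at most [40 * n.+1] steps and at least halves [x], so
    [n.+1] rounds are a generous bound. The code comes out with its first symbol
    at the bottom of [e]. *)
Lemma runs_to_binary n s : s x = nseq n true -> s y = [::] ->
  runs to_binary s tt (upd (upd s x [::]) e (catrev (encode_nat n) (s e)))
    (n.+1 * (n.+1 * 40) + 10).
Proof.
move=> sx sy.
(* The bound on a round is the one for [n], so that it is uniform in the
   induction; the closing symbol is pushed after the loop. *)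
suff main m s' : m <= n -> s' x = nseq m true -> s' y = [::] -> exists u,
    encode_nat m = rcons u false /\
    runs (loop (h <- top x ;;
      if h is Some _ then
        b <- halve ;; transfer y x ;; push e true ;; push e b ;; ret k None
      else ret k (Some tt))) s' tt
     (upd (upd s' x [::]) e (catrev u (s' e))) (m.+1 * (n.+1 * 40)).
  have [u [-> R]] := main n s (leqnn n) sx sy.
  apply: runs_le (_ : (n.+1 * (n.+1 * 40) + 2).+1 <= _); last by clear; lia.
  apply: runs_bind R _; apply: runs_eq (runs_push _ _ _) _ _ _ => //.
  by rewrite upd_upd upd_at -cats1 catrev_catl.
elim/ltn_ind: m s' {sx sy s} => -[|m] IH s mn sx sy.
  exists [::]; split=> //; apply: runs_loop_exit.
  apply: runs_le (_ : (0 + 0).+1 <= _); last by clear; lia.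
  apply: runs_bind (runs_top _ _) _; rewrite sx /=.
  by apply: runs_eq (runs_ret _ _) _ _ _ => //; store_eq.
have hm : m.+1./2 <= m by rewrite leq_half_double -addnn; clear; lia.
pose s1 := upd (upd s x (nseq m.+1./2 true)) e [:: odd m.+1, true & s e].
have [||||u [eu R]] := IH m.+1./2 _ s1.
- by rewrite ltnS.
- exact: leq_trans hm (ltnW mn).
- by rewrite /s1; upd_case.
- by rewrite /s1; upd_case.
exists [:: true, odd m.+1 & u]; split; first by rewrite encode_natE //= eu.
apply: runs_le (_ : (m.+2 * 10 + 7 * m.+1 + 20 + m.+1./2.+1 * (n.+1 * 40)).+1 <= _).
  apply: (runs_loop_again (s1 := s1)).
    apply: runs_le (_ : (0 + (m.+2 * 10 + (m.+1 * 7 + 1 + (2 + (2 + 0).+1).+1).+1).+1).+1 <= _);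
      last by clear; lia.
    apply: runs_bind (runs_top _ _) _; rewrite sx /=.
    apply: runs_bind (runs_halve sx) _.
    apply: runs_bind.
      apply: runs_eq (runs_transfer _ _) erefl erefl _; first by rewrite eq_sym.
      rewrite upd_at sy cats0 size_nseq; move: hm; clear; lia.
    apply: runs_bind (runs_push _ _ _) _.
    apply: runs_bind (runs_push _ _ _) _.
    apply: runs_eq (runs_ret _ _) _ _ _ => //.
    by rewrite /s1; store_eq; rewrite sy cats0 catrev_nseq0.
  apply: runs_eq R _ _ _ => //.
  by rewrite /s1; store_eq.
have : m.+1./2.+1 * (n.+1 * 40) <= m.+1 * (n.+1 * 40) by rewrite leq_mul2r ltnS hm orbT.
rewrite [m.+2 * (_ * _)]mulSn; move: (_ * _) (m.+1 * _) mn => X Y; clear; lia.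
Qed.

Lemma computes_to_binary (n : bits -> nat) st :
  (forall w, st w x = nseq (n w) true) -> (forall w, st w y = [::]) ->
  computes to_binary st
    (fun w => upd (upd (st w) x [::]) e (catrev (encode_nat (n w)) (st w e))).
Proof.
move=> Hx Hy; split=> -[d [pd K]].
exists (fun b => (d b).+1 * ((d b).+1 * 40) + 10); split.
  by repeat (apply: poly_boundedD || apply: poly_boundedM || apply: poly_boundedS
    || apply: pd || apply: poly_bounded_const).
move=> w; apply: runs_le (runs_to_binary (Hx w) (Hy w)) _.
have le : n w <= d (size w) by have := K w x; rewrite Hx size_nseq.
by rewrite leq_add2r leq_mul ?leq_mul2r.
Qed.

End Binary.
End Families.

(** * The program that prints the instance *)

(** [rW]: the input, and in the end the output. [rQ], [rM], [rU]: in unary, the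
    bound on the witness, its sum with the length of the input, and the horizon.
    [rX]: the number of vertices in unary; [rE], [rF]: its binary code, reversed
    and in order. [rO]: the output, reversed. [rt] to [rp']: the counters for
    the times and positions of two cells. [rY], [ta], [tb]: scratch. *)
Notation rW := (ord0 : 'I_15).
Notation rQ := (@Ordinal 15 1 isT).
Notation rM := (@Ordinal 15 2 isT).
Notation rU := (@Ordinal 15 3 isT).
Notation rX := (@Ordinal 15 4 isT).
Notation rY := (@Ordinal 15 5 isT).
Notation rE := (@Ordinal 15 6 isT).
Notation rF := (@Ordinal 15 7 isT).
Notation rO := (@Ordinal 15 8 isT).
Notation ta := (@Ordinal 15 9 isT).
Notation tb := (@Ordinal 15 10 isT).
Notation rt := (@Ordinal 15 11 isT).
Notation rp := (@Ordinal 15 12 isT).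
Notation rt' := (@Ordinal 15 13 isT).
Notation rp' := (@Ordinal 15 14 isT).

Notation store := ('I_15 -> bits).
Notation counters := [:: rt; rp; rt'; rp'; ta; tb].
Notation For := (for_ ta tb).

(** All that the constraints between two cells depend on, besides the cells
    themselves, is a finite amount of information about their times and
    positions; a program can collect it in its control. *)
Definition comparison := (bool * bool * bool)%type.

Definition compare (a b : nat) : comparison := (a == b, b == a.+1, a == b.+1).

Definition view := (bool * bool * option bool * bool)%type.

Definition view_at (w : bits) (Q t p : nat) : view := (t == 0, p == 0, onth w p, p < Q).

Definition observation := (view * view * comparison * comparison)%type.

Definition observe_at w Q t p t' p' : observation :=
  (view_at w Q t p, view_at w Q t' p', compare t t', compare p p').

Definition compare_prog (a b : 'I_15) : prog 14 comparison :=
  x <- lookup ta tb b a ;; y <- lookup ta tb a b ;;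
  ret _ ((x == None) && (y == None), x == Some false, y == Some false).

Definition view_prog (t p : 'I_15) : prog 14 view :=
  ht <- top t ;; hp <- top p ;; x <- lookup ta tb rW p ;; y <- lookup ta tb rQ p ;;
  ret _ (ht == None, hp == None, x, y != None).

Definition observe_prog : prog 14 observation :=
  x <- view_prog rt rp ;; y <- view_prog rt' rp' ;;
  a <- compare_prog rt rt' ;; b <- compare_prog rp rp' ;; ret _ (x, y, a, b).

(** Both accesses fail exactly when the numbers are equal, and the bottom symbol
    of a counter singles out consecutive numbers. *)
Lemma compare_ctr a b :
  let x := onth (ctr b) (size (ctr a)) in
  let y := onth (ctr a) (size (ctr b)) in
  ((x == None) && (y == None), x == Some false, y == Some false) = compare a b.
Proof.
rewrite /= !size_ctr !onth_ctr /compare.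
have S u : (Some u == Some false) = ~~ u by case: u.
have N m n : m < n -> (m == n.+1) = false by move=> lt; rewrite ltn_eqF // ltnW.
case: (ltngtP a b) => [ab|ab|->] //=.
- by rewrite S -leqNgt (eqn_leq b) ab andbT N.
- by rewrite S -leqNgt (eqn_leq a) ab andbT N.
by rewrite (ltn_eqF (ltnSn b)).
Qed.

Definition view_in (t p : 'I_15) (s : store) : view :=
  (ohead (s t) == None, ohead (s p) == None, onth (s rW) (size (s p)),
   onth (s rQ) (size (s p)) != None).

Definition compare_in (a b : 'I_15) (s : store) : comparison :=
  let x := onth (s b) (size (s a)) in let y := onth (s a) (size (s b)) in
  ((x == None) && (y == None), x == Some false, y == Some false).

Definition observe_in (s : store) : observation :=
  (view_in rt rp s, view_in rt' rp' s, compare_in rt rt' s, compare_in rp rp' s).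

Lemma probes_view t p : t != rO -> p != rO -> uniq [:: rW; p; ta; tb] ->
  uniq [:: rQ; p; ta; tb] -> probes rO [:: ta; tb] (view_prog t p) (view_in t p).
Proof.
move=> tO pO UW UQ.
apply: probes_bind (probes_top _ tO) _ _ => [ht|s].
  apply: probes_bind (probes_top _ pO) _ _ => [hp|s].
    apply: probes_bind => [|x|s]; first by apply: probes_lookup.
      apply: probes_bind => [|y|s]; [by apply: probes_lookup|exact: probes_ret|].
      by reflexivity.
    by reflexivity.
  by reflexivity.
by reflexivity.
Qed.

Lemma probes_compare a b : a != rO -> b != rO -> uniq [:: b; a; ta; tb] ->
  uniq [:: a; b; ta; tb] -> probes rO [:: ta; tb] (compare_prog a b) (compare_in a b).
Proof.
move=> aO bO Ub Ua.
apply: probes_bind => [|x|s]; first by apply: probes_lookup.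
  apply: probes_bind => [|y|s]; [by apply: probes_lookup|exact: probes_ret|].
  by reflexivity.
by reflexivity.
Qed.

Lemma probes_observe : probes rO [:: ta; tb] observe_prog observe_in.
Proof.
apply: probes_bind => [|x|s]; first by apply: probes_view.
  apply: probes_bind => [|y|s]; first by apply: probes_view.
    apply: probes_bind => [|a|s]; first by apply: probes_compare.
      apply: probes_bind => [|b|s]; [by apply: probes_compare|exact: probes_ret|].
      by reflexivity.
    by reflexivity.
  by reflexivity.
by reflexivity.
Qed.

Definition at_counters (s : store) t p t' p' : store :=
  upd (upd (upd (upd s rt (ctr t)) rp (ctr p)) rt' (ctr t')) rp' (ctr p').

Lemma observe_in_at w Q s t p t' p' : s rW = w -> s rQ = nseq Q true ->
  observe_in (at_counters s t p t' p') = observe_at w Q t p t' p'.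
Proof.
move=> sW sQ; rewrite /observe_in /view_in /compare_in.
set c := at_counters s t p t' p'.
have -> : c rt = ctr t by [].
have -> : c rp = ctr p by [].
have -> : c rt' = ctr t' by [].
have -> : c rp' = ctr p' by [].
have -> : c rW = w by rewrite -sW.
have -> : c rQ = nseq Q true by rewrite -sQ.
rewrite !compare_ctr !size_ctr.
have Z i : (ohead (ctr i) == None) = (i == 0) by case: i.
have L i : (onth (nseq Q true) i != None) = (i < Q) by rewrite onth_nseq; case: (i < Q).
by rewrite !Z !L.
Qed.

(** ** Loops over pairs of vertices *)

(** The loops over times and positions are executed, whereas those over the
    vertices of a group range over a fixed finite type and are unrolled. *)
Section PairLoop.
Variables (A : finType) (code : observation -> A -> A -> bits).

Definition pair_loop : prog 14 unit :=
  For rt rU (For rp rU (foldr (fun a Q => bind (For rt' rU (For rp' rU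
    (o <- observe_prog ;; pushes rO (flatten [seq code o a a' | a' <- enum A])))) (fun _ => Q))
    (ret _ tt) (enum A))).

Definition pair_output (T : nat) (F : nat -> nat -> nat -> nat -> observation) : bits :=
  flatten [seq flatten [seq flatten [seq
    flatten [seq flatten [seq flatten [seq code (F t p t' p') a a' | a' <- enum A]
     | p' <- iota 0 T] | t' <- iota 0 T]
   | a <- enum A] | p <- iota 0 T] | t <- iota 0 T].

Lemma prints_pair_loop : prints rO counters pair_loop
  (fun s => pair_output (size (s rU)) (fun t p t' p' => observe_in (at_counters s t p t' p'))).
Proof.
have inner a : prints rO [:: ta; tb]
    (o <- observe_prog ;; pushes rO (flatten [seq code o a a' | a' <- enum A]))
    (fun s => flatten [seq code (observe_in s) a a' | a' <- enum A]).
  exact: prints_bind probes_observe (fun o => prints_pushes rO _ _).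
have tab : ta != tb by [].
have two a := @prints_for 14 ta tb tab rO [:: ta; tb] rp' rU _ _
  isT isT isT isT isT isT isT (inner a).
have three a := @prints_for 14 ta tb tab rO [:: rp'; ta; tb] rt' rU _ _
  isT isT isT isT isT isT isT (two a).
have four := @prints_foldr 14 A rO [:: rt'; rp'; ta; tb] _ _ (enum A) isT three.
have five := @prints_for 14 ta tb tab rO [:: rt'; rp'; ta; tb] rp rU _ _
  isT isT isT isT isT isT isT four.
exact: (@prints_for 14 ta tb tab rO [:: rp; rt'; rp'; ta; tb] rt rU _ _
  isT isT isT isT isT isT isT five).
Qed.

End PairLoop.

Section Printer.
Variable alpha : rat.
Variables (q : {poly nat}) (M : machine) (time : {poly nat}).

Notation h := #|cell M|.
Notation T := (horizon q time).
Notation Q := (wbound q).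
Notation size_of w := (T w * T w * h).

Definition switching_code (o : observation) (d d' : cell M) : bits :=
  let: ((t0, p0, x, inb), (t0', p0', x', inb'), (et, lt, gt), (ep, lp, gp)) := o in
  encode_rat ((~~ (et && ep) &&
    ((bad_cell t0 p0 x inb d || bad_pair t0 p0 et lt ep lp gp d d') ||
     (bad_cell t0' p0' x' inb' d' || bad_pair t0' p0' et gt ep gp lp d' d)))%:R)%R.

Definition payoff_code (o : observation) (d d' : cell M) : bits :=
  let: (_, _, (et, _, _), (ep, _, _)) := o in
  encode_rat (if et && ep then same_group_weight alpha h else 0%R).

(** The order of the loops is that of the numbering of the vertices, hence of
    the rows and columns. *)
Lemma pair_output_mx w (code : observation -> cell M -> cell M -> bits)
    (B : 'M[rat]_(size_of w)) (g : nat -> nat -> bits) :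
  (forall i j, encode_rat (B i j) = g i j) ->
  (forall t p d t' p' d', t < T w -> p < T w -> d < h -> t' < T w -> p' < T w -> d' < h ->
    g ((t * T w + p) * h + d) ((t' * T w + p') * h + d') =
    code (observe_at w (Q w) t p t' p') (nth (cell0 M) (enum (cell M)) d)
      (nth (cell0 M) (enum (cell M)) d')) ->
  pair_output code (T w) (observe_at w (Q w)) = encode_mx B.
Proof.
move=> BE gE; rewrite (encode_mxE BE); symmetry.
apply: (flatten_vertices (a0 := cell0 M)) => t p d tT pT dh.
apply: (flatten_vertices (a0 := cell0 M)) => t' p' d' t'T p'T d'h.
exact: gE.
Qed.

Lemma same_vertex_group w t p d t' p' d' :
  t < T w -> p < T w -> d < h -> t' < T w -> p' < T w -> d' < h ->
  (((t * T w + p) * h + d) %/ h == ((t' * T w + p') * h + d') %/ h) =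
  (t == t') && (p == p').
Proof.
move=> tT pT dh t'T p'T d'h; have h0 : 0 < h by apply: leq_ltn_trans dh.
rewrite !divnMDl // !divn_small // !addn0; apply/eqP/andP => [e|[/eqP-> /eqP->] //].
have := congr1 (divn^~ (T w)) e; have := congr1 (modn^~ (T w)) e.
by rewrite /= !modnMDl !divnMDl // !modn_small // !divn_small // !addn0 => -> ->.
Qed.

Lemma switching_output w :
  pair_output switching_code (T w) (observe_at w (Q w)) =
  encode_mx (conflict_switching (T w * T w) h (conflict q M time w)).
Proof.
apply: (@pair_output_mx w switching_code _ (fun i j =>
  encode_rat ((clash h (conflict q M time w) i j)%:R)%R)) => [i j|]; first by rewrite mxE.
move=> t p d t' p' d' tT pT dh t'T p'T d'h; congr encode_rat; congr (_%:R)%R.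
rewrite /clash same_vertex_group // /conflict !vertexE //.
rewrite /bad_at /bad_between /= ![t' == t]eq_sym ![p' == p]eq_sym.
by [].
Qed.

Lemma payoff_output w :
  pair_output payoff_code (T w) (observe_at w (Q w)) =
  encode_mx (conflict_payoff alpha (T w * T w) h).
Proof.
apply: (@pair_output_mx w payoff_code _ (fun i j =>
  encode_rat (if i %/ h == j %/ h then same_group_weight alpha h else 0%R))) => [i j|].
  by rewrite mxE.
by move=> t p d t' p' d' tT pT dh t'T p'T d'h; rewrite same_vertex_group.
Qed.

(** ** The program *)

Definition copy : prog 14 unit :=
  For rt rF (c <- lookup ta tb rF rt ;; pushes rO (oapp (fun b => [:: b]) [::] c)).

Definition print_instance : prog 14 unit :=
  copy ;; copy ;; pair_loop switching_code ;; pair_loop payoff_code ;;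
  pushes rO (encode_int 1 ++ [:: false]) ;; copy.

(** Printing leaves the most recent symbol on top of [rO]; the final transfer
    reverses the output onto tape 0. *)
Definition printer : prog 14 unit :=
  eval_poly rW rQ rY rt rp ta tb q ;;
  For rt rW (pushes rM [:: true]) ;; For rt rQ (pushes rM [:: true]) ;;
  eval_poly rM rU rY rt rp ta tb time ;; pushes rU [:: true; true] ;;
  For rt rU (For rp rU (pushes rX (nseq h true))) ;;
  to_binary rX rY rE ;; transfer rE rF ;;
  print_instance ;; clear rW ;; transfer rO rW.

Lemma prints_weaken o zs zs' P f : {subset zs <= zs'} ->
  @prints 14 o zs P f -> prints o zs' P f.
Proof.
move=> sub [If [c [pc H]]]; split=> //; exists c; split=> // s b [z l].
by apply: H; split=> // r /sub; apply: z.
Qed.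

Let tab : ta != tb := isT.

Lemma prints_copy : prints rO counters copy (fun s => s rF).
Proof.
have lk := @probes_lookup 14 ta tb tab rO [:: ta; tb] rF rt isT isT isT isT isT.
have I := prints_bind lk (fun c => prints_pushes rO [:: ta; tb]
  (oapp (fun b => [:: b]) [::] c)).
have := @prints_for 14 ta tb tab rO [:: ta; tb] rt rF _ _
  isT isT isT isT isT isT isT I.
have -> : (fun s : store => flatten [seq oapp (fun b : bool => [:: b]) [::]
    (onth (upd s rt (ctr i) rF) (size (upd s rt (ctr i) rt)))
   | i <- iota 0 (size (s rF))]) = (fun s => s rF).
  apply: funext => s; rewrite -[RHS]flatten_onth; congr flatten.
  by apply: eq_map => i; rewrite upd_at size_ctr.
by apply: prints_weaken => r; rewrite !inE => /or3P[] ->; rewrite ?orbT.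
Qed.

Definition instance_output (s : store) : bits :=
  s rF ++ s rF ++
  pair_output switching_code (size (s rU))
    (fun t p t' p' => observe_in (at_counters s t p t' p')) ++
  pair_output payoff_code (size (s rU))
    (fun t p t' p' => observe_in (at_counters s t p t' p')) ++
  (encode_int 1 ++ [:: false]) ++ s rF.

Lemma prints_print_instance : prints rO counters print_instance instance_output.
Proof.
do 2 (apply: prints_seq => //; first exact: prints_copy).
do 2 (apply: prints_seq => //; first exact: prints_pair_loop).
apply: prints_seq => //; first exact: prints_pushes.
exact: prints_copy.
Qed.

Lemma prints_unary o r : uniq [:: r; rt; ta; tb] -> r != o -> rt != o -> o \notin [:: ta; tb] ->
  prints o [:: rt; ta; tb] (For rt r (pushes o [:: true])) (fun s => nseq (size (s r)) true).
Proof.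
move=> U ro xo oz.
have := @prints_for 14 ta tb tab o [:: ta; tb] rt r _ _
  U isT isT ro xo oz isT (prints_pushes o [:: ta; tb] [:: true]).
congr prints; apply: funext => s.
by have := flatten_nseq1 (size (s r)) true 1; rewrite muln1 => <-.
Qed.

Lemma prints_grid : prints rX [:: rt; rp; ta; tb]
  (For rt rU (For rp rU (pushes rX (nseq h true))))
  (fun s => nseq (size (s rU) * size (s rU) * h) true).
Proof.
have I := @prints_for 14 ta tb tab rX [:: ta; tb] rp rU _ _
  isT isT isT isT isT isT isT (prints_pushes rX [:: ta; tb] (nseq h true)).
have := @prints_for 14 ta tb tab rX [:: rp; ta; tb] rt rU _ _
  isT isT isT isT isT isT isT I.
congr prints; apply: funext => s; rewrite -mulnA -flatten_nseq1; congr flatten.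
by apply: eq_map => i; rewrite flatten_nseq1.
Qed.

Lemma blank (s : store) zs :
  all (fun r => s r == [::]) zs -> forall r, r \in zs -> s r = [::].
Proof. by move=> /allP H r /H /eqP. Qed.

Definition input w : store := upd (fun=> [::]) rW w.

Definition prepared w : store :=
  upd (upd (upd (upd (input w) rQ (nseq (Q w) true))
    rM (nseq (size w + Q w) true)) rU (nseq (T w) true)) rF (encode_nat (size_of w)).

(** The bound [1 / n] has the code of the integer 1 as numerator; the bit [false]
    is the sign of its denominator [n]. *)
Definition encoding w : bits :=
  encode_nat (size_of w) ++ encode_nat (size_of w) ++
  encode_mx (conflict_switching (T w * T w) h (conflict q M time w)) ++
  encode_mx (conflict_payoff alpha (T w * T w) h) ++
  (encode_int 1 ++ [:: false]) ++ encode_nat (size_of w).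

Lemma instance_output_prepared w : instance_output (prepared w) = encoding w.
Proof.
have F : prepared w rF = encode_nat (size_of w) by [].
have U : size (prepared w rU) = T w by rewrite -[RHS](size_nseq _ true).
rewrite /instance_output /encoding F U -switching_output -payoff_output.
have -> : (fun t p t' p' => observe_in (at_counters (prepared w) t p t' p')) =
    observe_at w (Q w).
  by do 4 (apply: funext => ?); apply: observe_in_at.
by [].
Qed.

Lemma computes_printer : exists st : bits -> store,
  computes printer input st /\ forall w, st w rW = encoding w.
Proof.
pose s1 w := upd (input w) rQ (nseq (Q w) true).
have c1 : computes (eval_poly rW rQ rY rt rp ta tb q) input s1.
  by apply: computes_eval_poly => // w; apply: blank.
pose s2 w := upd (s1 w) rM (nseq (size w + Q w) true).
pose s2' w := upd (s1 w) rM (nseq (size w) true).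
have c2' : computes (For rt rW (pushes rM [:: true])) s1 s2'.
  apply: computes_eq (computes_prints (prints_unary _ _ _ _) _) _ => // w.
    exact: blank.
  exact: (congr1 (upd (s1 w) rM) (catrev_nseq0 _ _)).
have c2 : computes (For rt rQ (pushes rM [:: true])) s2' s2.
  apply: computes_eq (computes_prints (prints_unary _ _ _ _) _) _ => // w.
    exact: blank.
  have e : size (s2' w rQ) = Q w by rewrite -[RHS](size_nseq _ true).
  by rewrite e {2}/s2' upd_at catrev_nseq addnC upd_upd.
pose s3 w := upd (s2 w) rU (nseq (T w).-2 true).
have c3 : computes (eval_poly rM rU rY rt rp ta tb time) s2 s3.
  apply: computes_eq (computes_eval_poly _ _ _) _ => // w; first exact: blank.
  by have -> : size (s2 w rM) = size w + Q w by rewrite -[RHS](size_nseq _ true).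
pose s4 w := upd (s2 w) rU (nseq (T w) true).
have c4 : computes (pushes rU [:: true; true]) s3 s4.
  by apply: computes_eq (computes_pushes _ _ _) _ => w; rewrite /s3 upd_upd.
pose s5 w := upd (s4 w) rX (nseq (size_of w) true).
have c5 : computes (For rt rU (For rp rU (pushes rX (nseq h true)))) s4 s5.
  apply: computes_eq (computes_prints prints_grid _) _ => w; first exact: blank.
  rewrite /s5 /s4 upd_at size_nseq.
  exact: (congr1 (upd (s4 w) rX) (catrev_nseq0 _ _)).
pose s6 w := upd (s4 w) rE (catrev (encode_nat (size_of w)) [::]).
have c6 : computes (to_binary rX rY rE) s5 s6.
  apply: computes_eq (computes_to_binary (n := fun w => size_of w) _ _ _ _ _) _ => // w.
  rewrite /s5 upd_upd; congr upd.
  by rewrite upd_id.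
have c7 : computes (transfer rE rF) s6 prepared.
  apply: computes_eq (computes_transfer _ _) _ => // w.
  have -> : s6 w rF = [::] by [].
  rewrite /s6 upd_at [catrev (catrev _ _) _]catrevE cats0 catrevE cats0 revK.
  by rewrite updC // upd_upd [upd (s4 w) rE _]upd_id.
pose s8 w := upd (prepared w) rO (catrev (encoding w) [::]).
have c8 : computes print_instance prepared s8.
  apply: computes_eq (computes_prints prints_print_instance _) _ => w; first exact: blank.
  by rewrite instance_output_prepared.
eexists; split.
  apply: computes_seq c1 (computes_seq c2' (computes_seq c2 (computes_seq c3 _))).
  apply: computes_seq c4 (computes_seq c5 (computes_seq c6 (computes_seq c7 _))).
  apply: computes_seq c8 (computes_seq (computes_clear _ _) _).
  exact: computes_transfer.
move=> w /=; rewrite upd_neq // upd_at upd_at upd_neq // /s8 upd_at.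
by rewrite [catrev (catrev _ _) _]catrevE cats0 catrevE cats0 revK.
Qed.

End Printer.


(** * Hardness *)

Theorem theorem1 (R : realType) (alpha : rat)
    (halpha0 : (0 < alpha)%R) (halpha1 : (alpha < 1)%R) :
  NP_hard_min (switching_game_problem R alpha).
Proof.
move=> L [V [q [[M [time HV]] HL]]].
have two : 0 < ntapes M by have [] := HV ([::], [::]).
have dec x y : computes_within M [:: x; y] [:: V x y] (time.[size x + size y])%R.
  by have [_] := HV (x, y); rewrite /= addn0.
exists (instance R halpha0 q M time); split; last first.
  by move=> w; rewrite HL; apply: instanceP.
have [st [[]]] := computes_printer alpha q M time.
case=> [|c [[P cP] H] stW].
  exists id; split; first exact: poly_bounded_id.
  by move=> w r; rewrite /input /upd; case: eqP.
exists (machine_of (printer alpha q M time)), P => w; split=> //.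
rewrite /= addn0.
have := machine_computes (H w) (cP (size w)); rewrite stW.
congr computes_within; rewrite /encoding /encode_game.
rewrite -!catA; congr (_ ++ (_ ++ (_ ++ (_ ++ _)))).
do 2 (congr (_ ++ _)); rewrite catA; symmetry; apply: encode_rat_inv.
by rewrite muln_gt0 cells_gt0.
Qed.
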